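(* Let $\mathcal P=\{\mathbb P_X\mathbb P_{Y\mid X}:\mathbb P_X\in\mathcal P_X,\ \mathbb P_{Y\mid X}\in\mathcal P_{Y\mid X}\}$, $\mathbb P^*=\mathbb P_X^*\mathbb P^*_{Y\mid X}\in\mathcal P$, $\theta:\mathcal P\to\Theta\subseteq\mathbb R^p$, and let $\frac{N}{n+N}\to\gamma\in(0,1)$. If the efficient influence function of $\theta(\cdot)$ at $\mathbb P^*$ relative to $\mathcal P$ (in the i.i.d. sense) is $\varphi^*_{\eta^*}$, then the efficient influence function of $\theta(\cdot)$ at $\mathbb P^*$ relative to $\mathcal P$ under the ordinary semi-supervised (OSS) setting is $$(z_1,x_2)\mapsto\big[\varphi^*_{\eta^*}(z_1)-\gamma\phi^*_{\eta^*}(x_1)\big]+\sqrt{\gamma(1-\gamma)}\,\phi^*_{\eta^*}(x_2),\qquad z_1=(x_1,y_1),$$ where $\phi^*_{\eta^*}(x)=\mathbb E[\varphi^*_{\eta^*}(Z)\mid X=x]$. Moreover, the semiparametric efficiency bound under the OSS setting can be expressed as $$\mathrm{Var}[\varphi^*_{\eta^*}(Z)-\gamma\phi^*_{\eta^*}(X)]+\mathrm{Var}[\sqrt{\gamma(1-\gamma)}\phi^*_{\eta^*}(X)]=\mathrm{Var}[\varphi^*_{\eta^*}(Z)]-\gamma\mathrm{Var}[\phi^*_{\eta^*}(X)]$$ $$=\mathrm{Var}[\varphi^*_{\eta^*}(Z)-\phi^*_{\eta^*}(X)]+(1-\gamma)\mathrm{Var}[\phi^*_{\eta^*}(X)].$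$
   Context: $Z=(X,Y)\in\mathcal Z=\mathcal X\times\mathcal Y$, $Z\sim\mathbb P^*$. OSS setting: one observes $\mathcal L_n=\{Z_i\}_{i=1}^n$ i.i.d. from $\mathbb P^*$ and, independently, $\mathcal U_N=\{X_i\}_{i=n+1}^{n+N}$ i.i.d. from $\mathbb P_X^*$. Models are dominated. $\mathcal L^2_{p,0}(\mathbb P)$: square-integrable mean-zero $\mathbb R^p$-valued functions. $\eta^*=\eta(\mathbb P^* )$ for a functional $\eta$; the subscript only records dependence on $\mathbb P^*$. i.i.d. notions: a one-dimensional regular parametric sub-model is $\{\mathbb P_t:t\in T\subset\mathbb R\}\subset\mathcal P$, $\mathbb P_{t^*}=\mathbb P^*$, differentiable in quadratic mean at $t^*$, with score $s_{t^*}(z)$; $s_{t^*,X}(x)$ denotes the score at $t^*$ of the induced marginal family $\{\mathbb P_{t,X}\}$. The tangent space $\mathcal T_{\mathcal P}(\mathbb P^* )$ is the closed linear span of the scores. $D\in\mathcal L^2_{p,0}(\mathbb P^* )$ is a gradient if $\frac{d}{dt}\theta(\mathbb P_t)|_{t=t^*}=\mathbb E[D(Z)s_{t^*}(Z)]$ for every sub-model, and the efficient influence function if also $a^\top D\in\mathcal T_{\mathcal P}(\mathbb P^* )$ for all $a\in\mathbb R^p$. OSS notions: let $\mathcal H$ be the Hilbert space of functions $f(z_1)+\frac{\gamma}{1-\gamma}g(x_2)$ with $f\in\mathcal L^2_{p,0}(\mathbb P^* )$, $g\in\mathcal L^2_{p,0}(\mathbb P_X^* )$ (any $p$), with $$\Big\langle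 f_1(z_1)+\tfrac{\gamma}{1-\gamma}g_1(x_2),\ f_2(z_1)^\top+\tfrac{\gamma}{1-\gamma}g_2(x_2)^\top\Big\rangle_{\mathcal H}=\mathbb E[f_1(Z)f_2(Z)^\top]+\tfrac{\gamma}{1-\gamma}\mathbb E[g_1(X)g_2(X)^\top].$$ The OSS score of a sub-model is $l_{t^*}(z_1,x_2)=s_{t^*}(z_1)+\frac{\gamma}{1-\gamma}s_{t^*,X}(x_2)$; the OSS tangent space is the closed linear span in $\mathcal H$ of all OSS scores. $D(z_1,x_2)\in\mathcal H$ is an OSS gradient if $\frac{d}{dt}\theta(\mathbb P_t)|_{t=t^*}=\langle l_{t^*},D\rangle_{\mathcal H}$ for every sub-model, and the OSS canonical gradient if also $a^\top D$ lies in the OSS tangent space for all $a\in\mathbb R^p$. Normalization: in the OSS setting an estimator $\hat\theta_{n,N}$ is asymptotically linear with influence function $\varphi^{(1)}(z_1)+\varphi^{(2)}(x_2)$, $\varphi^{(1)}\in\mathcal L^2_{p,0}(\mathbb P^* )$, $\varphi^{(2)}\in\mathcal L^2_{p,0}(\mathbb P_X^* )$, if $$\sqrt n(\hat\theta_{n,N}-\theta^* )=\tfrac1{\sqrt n}\sum_{i=1}^n\varphi^{(1)}(Z_i)+\tfrac1{\sqrt N}\sum_{i=n+1}^{n+N}\varphi^{(2)}(X_i)+o_p(1),$$ so its asymptotic variance is $\mathrm{Var}[\varphi^{(1)}(Z)]+\mathrm{Var}[\varphi^{(2)}(X)]$. In this normalization (used in the claim), $\varphi^{(1)}(z_1)+\varphi^{(2)}(x_2)$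 is the efficient influence function under the OSS setting when $\varphi^{(1)}(z_1)+\sqrt{\gamma/(1-\gamma)}\,\varphi^{(2)}(x_2)$ is the OSS canonical gradient in $\mathcal H$. The OSS semiparametric efficiency bound is $\mathrm{Var}[\varphi^{(1)}(Z)]+\mathrm{Var}[\varphi^{(2)}(X)]$ for the efficient influence function (equivalently, the $\mathcal H$ outer product of the canonical gradient with itself). *)

(* Defs.v *)
From HB Require Import structures.
From mathcomp Require Import all_boot all_order all_algebra.
From mathcomp Require Import all_classical all_reals all_analysis.

Set Implicit Arguments.
Unset Strict Implicit.
Unset Printing Implicit Defensive.

Import Order.TTheory GRing.Theory Num.Theory.
Import numFieldNormedType.Exports.

Local Open Scope classical_set_scope.
Local Open Scope ring_scope.

Section marginal.
Context dX dY (X : measurableType dX) (Y : measurableType dY) (R : realType).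

Definition proj_fst (z : X * Y) : X := z.1.

Let measurable_proj_fst : measurable_fun [set: X * Y] proj_fst.
Proof. exact: measurable_fst. Qed.

HB.instance Definition _ :=
  @isMeasurableFun.Build _ _ (X * Y)%type X proj_fst measurable_proj_fst.

Definition marginal (P : probability (X * Y)%type R) : probability X R :=
  distribution P proj_fst.

End marginal.

Section square_integrable.
Context d (U : measurableType d) (R : realType).

Definition L20 (P : probability U R) (f : U -> R) : Prop :=
  f \in Lfun P 2%:E /\ 'E_P[f]%E = 0%E.

Definition coordinate p (f : U -> 'cV[R]_p) (i : 'I_p) : U -> R :=
  fun u => f u i 0.

Definition L20vec p (P : probability U R) (f : U -> 'cV[R]_p) : Prop :=
  forall i, L20 P (coordinate f i).

Definition lincomb p (a : 'cV[R]_p) (f : U -> 'cV[R]_p) : U -> R :=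
  fun u => (a^T *m f u) 0 0.

Definition covmx p (P : probability U R) (f : U -> 'cV[R]_p) : 'M[R]_p :=
  \matrix_(i, j) fine (covariance P (coordinate f i) (coordinate f j)).

End square_integrable.

Section submodels.
Context d (U : measurableType d) (R : realType).

Definition is_density (mu : set U -> \bar R) (P : probability U R)
    (p : U -> R) : Prop :=
  [/\ measurable_fun setT p, (forall u, 0 <= p u) &
      forall A, measurable A -> P A = (\int[mu]_(u in A) (p u)%:E)%E].

(* Differentiability in quadratic mean at t0 with score s.  It does not depend
   on the dominating measure and densities.  For t0 interior to I, the
   limit already forces s to be square-integrable with mean zero under P t0. *)
Definition is_score (I : set R) (t0 : R) (P : R -> probability U R)
    (s : U -> R) : Prop :=
  L20 (P t0) s /\
  exists (mu : {sigma_finite_measure set U -> \bar R}) (p : R -> U -> R),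
    (forall t, I t -> is_density mu (P t) (p t)) /\
    ((\int[mu]_u ((Num.sqrt (p t u) - Num.sqrt (p t0 u)
                  - (t - t0) / 2 * s u * Num.sqrt (p t0 u)) ^+ 2)%:E)
       * ((t - t0) ^- 2)%:E)%E @[t --> t0^'] --> 0%E.

Definition regular_submodel (model : set (probability U R))
    (Pstar : probability U R) (I : set R) (t0 : R) (P : R -> probability U R)
    (s : U -> R) : Prop :=
  [/\ open I, I t0, (forall t, I t -> model (P t)), P t0 = Pstar &
      is_score I t0 P s].

Definition tangent_space (model : set (probability U R))
    (Pstar : probability U R) (h : U -> R) : Prop :=
  L20 Pstar h /\
  forall e : R, 0 < e ->
    exists (n : nat) (c : 'I_n -> R) (s : 'I_n -> U -> R),
      (forall k, exists I t0 P, regular_submodel model Pstar I t0 P (s k)) /\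
      ('E_Pstar[fun u => ((h u - \sum_k c k * s k u) ^+ 2)%R] < e%:E)%E.

Definition is_gradient p (model : set (probability U R))
    (theta : probability U R -> 'cV[R]_p) (Pstar : probability U R)
    (D : U -> 'cV[R]_p) : Prop :=
  L20vec Pstar D /\
  forall I t0 P s, regular_submodel model Pstar I t0 P s ->
    forall i, is_derive t0 1 (fun t => theta (P t) i 0)
      (fine 'E_Pstar[fun u => (coordinate D i u * s u)%R]%E).

Definition is_eif p (model : set (probability U R))
    (theta : probability U R -> 'cV[R]_p) (Pstar : probability U R)
    (D : U -> 'cV[R]_p) : Prop :=
  is_gradient model theta Pstar D /\
  forall a, tangent_space model Pstar (lincomb a D).

End submodels.

Section product_model.
Context dX dY (X : measurableType dX) (Y : measurableType dY) (R : realType).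
Local Notation Z := (X * Y)%type.

Definition product_model (PX : set (probability X R))
    (PYX : set (R.-pker X ~> Y)) : set (probability Z R) :=
  [set P | exists Q K, [/\ PX Q, PYX K & forall A, measurable A ->
     P A = (\int[Q]_x K x (xsection A x))%E]].

(* phi is a version of x |-> E[f(Z) | X = x]. *)
Definition is_cond_exp p (P : probability Z R) (f : Z -> 'cV[R]_p)
    (phi : X -> 'cV[R]_p) : Prop :=
  forall i, (marginal P).-integrable setT (EFin \o coordinate phi i) /\
    forall A, measurable A ->
      (\int[marginal P]_(x in A) (coordinate phi i x)%:E
       = \int[P]_(z in fst @^-1` A) (coordinate f i z)%:E)%E.

End product_model.

Section ordinary_semi_supervised.
Context dX dY (X : measurableType dX) (Y : measurableType dY) (R : realType).
Local Notation Z := (X * Y)%type.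
Variables (gamma : R) (model : set (probability Z R)) (Pstar : probability Z R).

(* The element f(z1) + gamma / (1 - gamma) g(x2) of the Hilbert space; f and g
   are determined by it, since they are centered. *)
Definition oss_fun p (f : Z -> 'cV[R]_p) (g : X -> 'cV[R]_p) :
    Z * X -> 'cV[R]_p :=
  fun w => f w.1 + (gamma / (1 - gamma)) *: g w.2.

(* The inner product of f1 + gamma / (1 - gamma) g1 and
   f2 + gamma / (1 - gamma) g2, for scalar functions; the matrix-valued inner
   product of vector functions has the inner products of their coordinates as
   entries. *)
Definition oss_inner (f1 : Z -> R) (g1 : X -> R) (f2 : Z -> R) (g2 : X -> R) :
    R :=
  fine 'E_Pstar[fun z => (f1 z * f2 z)%R]%E
  + gamma / (1 - gamma) * fine 'E_(marginal Pstar)[fun x => (g1 x * g2 x)%R]%E.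

(* (s, sX) stands for the OSS score s(z1) + gamma / (1 - gamma) sX(x2). *)
Definition oss_score (I : set R) (t0 : R) (P : R -> probability Z R)
    (s : Z -> R) (sX : X -> R) : Prop :=
  regular_submodel model Pstar I t0 P s /\
  is_score I t0 (fun t => marginal (P t)) sX.

Definition oss_tangent_space (f : Z -> R) (g : X -> R) : Prop :=
  [/\ L20 Pstar f, L20 (marginal Pstar) g &
  forall e : R, 0 < e ->
    exists (n : nat) (c : 'I_n -> R) (s : 'I_n -> Z -> R) (sX : 'I_n -> X -> R),
      (forall k, exists I t0 P, oss_score I t0 P (s k) (sX k)) /\
      let rf := fun z => f z - \sum_k c k * s k z in
      let rg := fun x => g x - \sum_k c k * sX k x in
      oss_inner rf rg rf rg < e].

Definition is_oss_gradient p (theta : probability Z R -> 'cV[R]_p)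
    (f : Z -> 'cV[R]_p) (g : X -> 'cV[R]_p) : Prop :=
  [/\ L20vec Pstar f, L20vec (marginal Pstar) g &
  forall I t0 P s sX, oss_score I t0 P s sX ->
    forall i, is_derive t0 1 (fun t => theta (P t) i 0)
      (oss_inner s sX (coordinate f i) (coordinate g i))].

Definition is_oss_canonical_gradient p (theta : probability Z R -> 'cV[R]_p)
    (D : Z * X -> 'cV[R]_p) : Prop :=
  exists f g, [/\ D = oss_fun f g, is_oss_gradient theta f g &
    forall a, oss_tangent_space (lincomb a f) (lincomb a g)].

(* The influence function phi1(z1) + phi2(x2), where phi1 and phi2 are
   multiplied by n^(-1/2) and N^(-1/2) in the asymptotic expansion. *)
Definition is_oss_eif p (theta : probability Z R -> 'cV[R]_p)
    (phi1 : Z -> 'cV[R]_p) (phi2 : X -> 'cV[R]_p) : Prop :=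
  [/\ L20vec Pstar phi1, L20vec (marginal Pstar) phi2 &
  is_oss_canonical_gradient theta
    (fun w => phi1 w.1 + Num.sqrt (gamma / (1 - gamma)) *: phi2 w.2)].

Definition is_oss_efficiency_bound p (theta : probability Z R -> 'cV[R]_p)
    (V : 'M[R]_p) : Prop :=
  exists phi1 phi2, is_oss_eif theta phi1 phi2 /\
    V = covmx Pstar phi1 + covmx (marginal Pstar) phi2.

End ordinary_semi_supervised.

(* Main.v *)
Require Import Defs.
From HB Require Import structures.
From mathcomp Require Import all_boot all_order all_algebra.
From mathcomp Require Import finmap ring lra.
From mathcomp Require Import all_classical all_reals all_analysis.
From mathcomp Require Import measurable_realfun.

(** Write Pstar = Q0 K.  In the OSS setting, a submodel P_t with score s
    contributes the score (s, sigma), sigma = E[s | X]: the marginals P_(t, X) are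
    differentiable in quadratic mean because the Hellinger affinity does not
    decrease under marginalization, which reduces the claim to the path
    (1 + h s / 2)^2 Pstar, whose marginal is explicit.  Since the conditional law
    K may be kept fixed, P_(t, X) K is a submodel too, with score (sigma, sigma).
    Hence the OSS tangent space contains
    (s, sigma) - gamma (sigma, sigma) = (s - gamma sigma, (1 - gamma) sigma),
    and s |-> (s - gamma sigma, (1 - gamma) sigma) is a contraction that maps the
    i.i.d. efficient influence function to the announced OSS gradient.  An OSS
    canonical gradient is unique, as the difference of two of them is both
    orthogonal to the scores and in their closed span. *)

Set Implicit Arguments.
Unset Strict Implicit.
Unset Printing Implicit Defensive.

Import Order.TTheory GRing.Theory Num.Theory.
Import numFieldNormedType.Exports.

Local Open Scope classical_set_scope.
Local Open Scope ring_scope.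

(** The constant gamma comes from two requirements on a pair (varphi - a phi, b phi). Every OSS
    score is (s, E[s | X]), so membership in the OSS tangent space asks for b = 1 - a. Pairing with
    (s, sigma) gives E[varphi s] - a E[phi sigma] + (gamma / (1 - gamma)) b E[phi sigma], whose last
    two terms cancel for a = gamma. The obstacle is that an OSS score demands differentiability in
    quadratic mean of the marginal submodel too, and admits any score of it. For existence, the
    dominating measure is first replaced by an equivalent probability, because the marginal of a
    sigma-finite measure need not be sigma-finite. Moreover the marginal of (1 + h s / 2)^2 Pstar
    has density 1 + h sigma + (h / 2)^2 E[s^2 | X] with respect to Q0, which is not a perfect
    square: its root must be expanded in quadratic mean although E[s^2 | X] is merely integrable.
    Uniqueness follows by differentiating the probability of {X in B} in two ways. *)

Section integral_characterization.
Local Open Scope ereal_scope.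
Context d (T : measurableType d) (R : realType).
Import HBNNSimple.

(** The passage from indicators to simple functions to monotone limits, done once. It serves both
    for integration against a density and for iterated integrals over a kernel. *)
Lemma ge0_integral_characterization (kappa : {measure set T -> \bar R})
    (Phi : (T -> \bar R) -> \bar R) :
  (forall A, measurable A -> Phi (fun x => (\1_A x)%:E) = kappa A) ->
  (forall f g : T -> \bar R,
     measurable_fun setT f -> (forall x, 0 <= f x) ->
     measurable_fun setT g -> (forall x, 0 <= g x) ->
     Phi (fun x => f x + g x) = Phi f + Phi g) ->
  (forall (c : R) (f : T -> \bar R), (0 <= c)%R ->
     measurable_fun setT f -> (forall x, 0 <= f x) ->
     Phi (fun x => c%:E * f x) = c%:E * Phi f) ->
  (forall g : nat -> T -> \bar R, (forall n, measurable_fun setT (g n)) ->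
     (forall n x, 0 <= g n x) -> (forall x, nondecreasing_seq (g ^~ x)) ->
     Phi (fun x => limn (g ^~ x)) = limn (fun n => Phi (g n))) ->
  forall f : T -> \bar R, measurable_fun setT f -> (forall x, 0 <= f x) ->
    Phi f = \int[kappa]_x f x.
Proof.
move=> Phi1 PhiD PhiZ Philim f mf f0.
have mE (h : {nnsfun T >-> R}) r : measurable_fun setT (fun x => r%:E * (\1_(h @^-1` [set r]) x)%:E : \bar R).
  by apply: emeasurable_funM => //; exact/measurable_EFinP/measurable_indic.
have Phi0 : Phi (fun=> 0) = 0.
  rewrite (_ : (fun=> 0) = fun x => (\1_(@set0 T) x)%:E).
    by rewrite Phi1// measure0.
  by apply/funext => x; rewrite indic0.
have Phinn (h : {nnsfun T >-> R}) : Phi (EFin \o h) = \int[kappa]_x (h x)%:E.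
  have hE : EFin \o h = fun x => \sum_(r <- enum_fset (fset_set (range h)))
      (r%:E * (\1_(h @^-1` [set r]) x)%:E).
    apply/funext => x /=; rewrite {1}(fimfunE h x) fsbig_finite//=.
    by rewrite -sumEFin.
  have r0 r (rh : r \in enum_fset (fset_set (range h))) : (0 <= r)%R.
    have : r \in fset_set (range h) by [].
    by rewrite in_fset_set// inE => -[x _ <-].
  rewrite [RHS](_ : _ = \int[kappa]_x (EFin \o h) x)// hE.
  (* The induction runs over an arbitrary list of values, of which only nonnegativity is kept. *)
  elim: (enum_fset _) r0 => [|a s IH] rs.
    rewrite (_ : (fun _ => _) = fun=> 0); first by rewrite Phi0 integral0.
    by apply/funext => x; rewrite big_nil.
  have a0 : (0 <= a)%R by apply: rs; rewrite mem_head.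
  have s0 r : r \in s -> (0 <= r)%R by move=> rs'; apply: rs; rewrite inE rs' orbT.
  have ms : measurable_fun setT (fun x => \sum_(r <- s) (r%:E * (\1_(h @^-1` [set r]) x)%:E)).
    by apply: emeasurable_sum.
  have s00 x : 0 <= \sum_(r <- s) (r%:E * (\1_(h @^-1` [set r]) x)%:E).
    rewrite big_seq; apply: sume_ge0 => r rs'.
    by apply: mule_ge0; rewrite lee_fin//; exact: s0.
  rewrite (_ : (fun _ => _) = fun x => a%:E * (\1_(h @^-1` [set a]) x)%:E +
      \sum_(r <- s) (r%:E * (\1_(h @^-1` [set r]) x)%:E)); last first.
    by apply/funext => x; rewrite big_cons.
  rewrite PhiD//; last first.
    by move=> x; rewrite mule_ge0 ?lee_fin.
  rewrite ge0_integralD//; last first.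
    by move=> x _; rewrite mule_ge0 ?lee_fin.
  rewrite IH// PhiZ//; last first.
    exact/measurable_EFinP/measurable_indic.
  rewrite Phi1// ge0_integralZl//; last first.
    exact/measurable_EFinP/measurable_indic.
  by rewrite integral_indic// setIT.
pose f_ := nnsfun_approx measurableT mf.
have fE : f = fun x => limn (fun n => (f_ n x)%:E).
  by apply/funext => x; apply/esym/cvg_lim => //; apply: cvg_nnsfun_approx.
rewrite {1}fE Philim.
- under eq_fun do rewrite -/(EFin \o f_ _) Phinn.
  rewrite fE monotone_convergence//.
  + by move=> n; exact/measurable_EFinP.
  + by move=> n x _; rewrite lee_fin.
  + by move=> x _ a b ab; rewrite lee_fin; exact/lefP/nd_nnsfun_approx.
- by move=> n; exact/measurable_EFinP.
- by move=> n x; rewrite lee_fin.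
- by move=> x a b ab; rewrite lee_fin; exact/lefP/nd_nnsfun_approx.
Qed.

Lemma ge0_integral_density (mu kappa : {measure set T -> \bar R}) (p : T -> R) :
  measurable_fun setT p -> (forall x, (0 <= p x)%R) ->
  (forall A, measurable A -> kappa A = \int[mu]_(x in A) (p x)%:E) ->
  forall f : T -> \bar R, measurable_fun setT f -> (forall x, 0 <= f x) ->
    \int[kappa]_x f x = \int[mu]_x (f x * (p x)%:E).
Proof.
move=> mp p0 pE f mf f0; apply/esym.
have mp' : measurable_fun setT (EFin \o p) by exact/measurable_EFinP.
have p0' x : 0 <= (p x)%:E by rewrite lee_fin.
apply: (ge0_integral_characterization (Phi := fun f => \int[mu]_x (f x * (p x)%:E)))
  => //.
- move=> A mA; rewrite pE// [RHS]integral_mkcond; apply: eq_integral => x _.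
  by rewrite patchE indicE; case: (x \in A); rewrite ?mul1e ?mul0e.
- move=> g h mg g0 mh h0; rewrite -ge0_integralD//.
  + by apply: eq_integral => x _; rewrite ge0_muleDl.
  + by move=> x _; rewrite mule_ge0.
  + exact: emeasurable_funM.
  + by move=> x _; rewrite mule_ge0.
  + exact: emeasurable_funM.
- move=> c g c0 mg g0; rewrite -ge0_integralZl//.
  + by apply: eq_integral => x _; rewrite muleA.
  + exact: emeasurable_funM.
  + by move=> x _; rewrite mule_ge0.
- move=> g mg g0 ndg; rewrite -monotone_convergence//.
  + apply: eq_integral => x _; rewrite -limeMr//.
    by apply: ereal_nondecreasing_is_cvgn.
  + by move=> n; exact: emeasurable_funM.
  + by move=> n x _; rewrite mule_ge0.
  + by move=> x _ a b ab; rewrite lee_wpmul2r//; exact: ndg.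
Qed.

End integral_characterization.

(** * Semidirect products of a measure and a probability kernel *)

Section joint.
Local Open Scope ereal_scope.
Context dX dY (X : measurableType dX) (Y : measurableType dY) (R : realType).
Implicit Type K : R.-pker X ~> Y.

(** The law of (x, y) with x drawn from [nu] and y from [K x], in the form that occurs in
    [product_model]. *)
Definition joint (nu : {measure set X -> \bar R}) K (A : set (X * Y)) : \bar R :=
  \int[nu]_x K x (xsection A x).

Lemma measurable_ksection K (f : X * Y -> \bar R) :
  measurable_fun setT f -> (forall z, 0 <= f z) ->
  measurable_fun setT (fun x => \int[K x]_y f (x, y)).
Proof. by move=> mf f0; exact: measurable_kfcomp. Qed.

Lemma ksection_indic K A x : measurable A ->
  \int[K x]_y (\1_A (x, y))%:E = K x (xsection A x).
Proof. by move=> mA; have := @kfcompkindic _ _ _ _ _ K _ mA; move/(congr1 (@^~ x)). Qed.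

Lemma measurable_kxsection K A : measurable A ->
  measurable_fun setT (fun x => K x (xsection A x)).
Proof.
move=> mA; rewrite -(kfcompkindic K mA); apply: measurable_kfcomp.
- exact/measurable_EFinP/measurable_indic.
- by move=> z; rewrite lee_fin.
Qed.

Lemma measurable_fun_section (f : X * Y -> \bar R) x :
  measurable_fun setT f -> measurable_fun setT (fun y => f (x, y)).
Proof. by move=> mf; apply: measurableT_comp mf _; exact: pair1_measurable. Qed.

Section joint_measure.
Variables (nu : {measure set X -> \bar R}) (K : R.-pker X ~> Y).

Let joint0 : joint nu K set0 = 0.
Proof.
rewrite /joint; under eq_integral do rewrite xsection0 measure0.
by rewrite integral0.
Qed.

Let joint_ge0 A : 0 <= joint nu K A.
Proof. exact: integral_ge0. Qed.

Let joint_sigma_additive : semi_sigma_additive (joint nu K).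
Proof.
move=> F mF tF mUF; rewrite [X in _ --> X](_ : _ =
    \sum_(0 <= k <oo) joint nu K (F k)).
  by apply: is_cvg_ereal_nneg_natsum => k _.
rewrite /joint -integral_nneseries//; last first.
  by move=> n; exact: measurable_kxsection.
apply: eq_integral => x _; rewrite xsection_bigcup.
apply/esym/cvg_lim => //; apply: measure_semi_sigma_additive.
- by move=> k; exact: measurable_xsection.
- exact: trivIset_xsection.
- by apply: bigcup_measurable => k _; exact: measurable_xsection.
Qed.

HB.instance Definition _ := isMeasure.Build _ _ _ (joint nu K)
  joint0 joint_ge0 joint_sigma_additive.

Lemma jointT : joint nu K setT = nu setT.
Proof.
rewrite /joint -[RHS]mul1e -integral_cst//; apply: eq_integral => x _.
rewrite (_ : xsection setT _ = setT) ?prob_kernel//.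
by apply/seteqP; split => // y _; rewrite /xsection /= in_setT.
Qed.

(** Stated for any [kappa] that agrees with [joint nu K] on measurable sets, as this is all that
    membership in [product_model] provides. *)
Lemma ge0_integral_joint (kappa : {measure set (X * Y) -> \bar R}) :
  (forall A, measurable A -> kappa A = joint nu K A) ->
  forall f : X * Y -> \bar R, measurable_fun setT f -> (forall z, 0 <= f z) ->
    \int[kappa]_z f z = \int[nu]_x \int[K x]_y f (x, y).
Proof.
move=> kE f mf f0; apply/esym.
apply: (ge0_integral_characterization
  (Phi := fun f => \int[nu]_x \int[K x]_y f (x, y))) => //.
- move=> A mA; rewrite kE//; apply: eq_integral => x _.
  exact: ksection_indic.
- move=> g h mg g0 mh h0; rewrite -ge0_integralD//; last 4 first.
  + by move=> x _; apply: integral_ge0.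
  + exact: measurable_ksection.
  + by move=> x _; apply: integral_ge0.
  + exact: measurable_ksection.
  apply: eq_integral => x _; rewrite -ge0_integralD//;
    exact: measurable_fun_section.
- move=> c g c0 mg g0; rewrite -ge0_integralZl//; last 2 first.
  + exact: measurable_ksection.
  + by move=> x _; apply: integral_ge0.
  apply: eq_integral => x _; rewrite -ge0_integralZl//.
  exact: measurable_fun_section.
- move=> g mg g0 ndg; rewrite -monotone_convergence//.
  + apply: eq_integral => x _; rewrite -monotone_convergence//.
    by move=> n; exact: measurable_fun_section.
  + by move=> n; exact: measurable_ksection.
  + by move=> n x _; apply: integral_ge0.
  + move=> x _ a b ab; apply: ge0_le_integral => //.
    * exact: measurable_fun_section.
    * exact: measurable_fun_section.
    * by move=> y _; exact: ndg.
Qed.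

End joint_measure.

Section joint_probability.
Variables (nu : probability X R) (K : R.-pker X ~> Y).

Let joint_setT : joint nu K setT = 1.
Proof. by rewrite jointT; exact: probability_setT. Qed.

HB.instance Definition _ := Measure_isProbability.Build _ _ _ (joint nu K)
  joint_setT.

Definition joint_prob : probability (X * Y)%type R := joint nu K.

End joint_probability.

End joint.

(** * Square integrability, densities and change of the dominating measure *)

Section square_integrable_functions.
Context d (T : measurableType d) (R : realType).
Implicit Type P : probability T R.

Lemma Lfun2P P (f : T -> R) : f \in Lfun P 2%:E <->
  measurable_fun setT f /\ (\int[P]_x (f x ^+ 2)%:E < +oo)%E.
Proof.
split=> [fL|[mf f2]].
  split; first by move: fL; rewrite inE => /andP[]; rewrite inE.
  have /integrableP[_] := Lfun2_integrable_sqr fL.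
  by under eq_integral do rewrite /= ger0_norm ?sqr_ge0//.
rewrite inE; apply/andP; split; rewrite inE//=.
rewrite /finite_norm unlock /=.
apply: poweR_lty.
rewrite (_ : (\int[P]_x _)%E = (\int[P]_x (f x ^+ 2)%:E)%E)//.
apply: eq_integral => x _ /=.
by rewrite powR_mulrn// real_normK// num_real.
Qed.

Lemma Lfun2_measurable P (f : T -> R) : f \in Lfun P 2%:E -> measurable_fun setT f.
Proof. by move=> /Lfun2P[]. Qed.

End square_integrable_functions.

Section density_probability.
Local Open Scope ereal_scope.
Context d (T : measurableType d) (R : realType).
Variables (mu : {measure set T -> \bar R}) (w : T -> R).

(** The hypotheses on [w] are arguments so that the measure and probability structures declared
    below can be recovered from the term itself. *)
Definition density_measure & measurable_fun setT w & (forall x, (0 <= w x)%R)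
  & \int[mu]_x (w x)%:E = 1 := fun A : set T => \int[mu]_(x in A) (w x)%:E.

Hypotheses (mw : measurable_fun setT w) (w0 : forall x, (0 <= w x)%R)
  (w1 : \int[mu]_x (w x)%:E = 1).

Let density_measure0 : density_measure mw w0 w1 set0 = 0.
Proof. by rewrite /density_measure integral_set0. Qed.

Let density_measure_ge0 A : 0 <= density_measure mw w0 w1 A.
Proof. by apply: integral_ge0 => x _; rewrite lee_fin. Qed.

Let density_measure_sigma_additive : semi_sigma_additive (density_measure mw w0 w1).
Proof.
move=> F mF tF mUF; rewrite [X in _ --> X](_ : _ =
    \sum_(0 <= k <oo) density_measure mw w0 w1 (F k)).
  by apply: is_cvg_ereal_nneg_natsum => k _.
rewrite /density_measure ge0_integral_bigcup//.
- exact/measurable_EFinP/measurable_funTS.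
- by move=> x _; rewrite lee_fin.
Qed.

HB.instance Definition _ := isMeasure.Build _ _ _ (density_measure mw w0 w1)
  density_measure0 density_measure_ge0 density_measure_sigma_additive.

HB.instance Definition _ := Measure_isProbability.Build _ _ _
  (density_measure mw w0 w1) w1.

Lemma density_probability : exists m : probability T R,
  forall A, m A = \int[mu]_(x in A) (w x)%:E.
Proof. by exists (density_measure mw w0 w1). Qed.

End density_probability.

Section domination.
Local Open Scope ereal_scope.
Context d (T : measurableType d) (R : realType).

(** The density [w] is positive everywhere, so that densities with respect to [mu] can be divided by
    it. *)
Lemma sigma_finite_equivalent_probability
    (mu : {sigma_finite_measure set T -> \bar R}) : mu setT != 0 ->
  exists (m : probability T R) (w : T -> R),
    is_density mu m w /\ forall x, (0 < w x)%R.
Proof.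
move=> muT; have [F TF /all_and2[mF Foo]] := sigma_finiteT mu.
pose e n : R := (1 / (2 ^ n.+1)%:R)%R.
have e0 n : (0 < e n)%R by rewrite divr_gt0// ltr0n expn_gt0.
(* The denominator is at least 1 and at least mu (F n). Hence the sums of c n and of c n mu (F n)
   are both at most 1, which bounds [g] pointwise and bounds its integral [W]. *)
pose c n : R := (e n / (1 + fine (mu (F n))))%R.
have mu0 n : (0 <= fine (mu (F n)))%R by rewrite fine_ge0.
have c0 n : (0 < c n)%R.
  by rewrite /c divr_gt0// ltr_pwDl.
have mterm n : measurable_fun setT (fun x => (c n * \1_(F n) x)%:E : \bar R).
  by apply/measurable_EFinP; apply: measurable_funM.
have term0 n x : 0 <= (c n * \1_(F n) x)%:E.
  by rewrite lee_fin mulr_ge0// ltW.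
pose g x : \bar R := \sum_(0 <= n <oo) (c n * \1_(F n) x)%:E.
have mg : measurable_fun setT g by apply: ge0_emeasurable_sum.
have geo : \sum_(0 <= n <oo) (e n)%:E <= 1 by exact: epsilon_trick0.
have g1 x : g x <= 1.
  apply: le_trans geo; apply: lee_nneseries => // n _.
  rewrite lee_fin /c mulrAC ler_pdivrMr ?ltr_pwDl// ler_wpM2l//; first exact: ltW.
  rewrite indicE; case: (_ \in _) => /=; last by rewrite addr_ge0.
  by rewrite lerDl.
have g0 x : 0 < g x.
  have : setT x by []; rewrite TF => -[n _ Fnx].
  apply: (@lt_le_trans _ _ (c n * \1_(F n) x)%:E).
    by rewrite lte_fin indicE mem_set// mulr1.
  rewrite /g (@nneseriesD1 _ _ n)// leeDl//.
  by apply: nneseries_ge0 => k _ _; exact: term0.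
have gfin x : g x \is a fin_num.
  by rewrite ge0_fin_numE ?(le_lt_trans (g1 x)) ?ltry// ltW.
pose W := \int[mu]_x g x.
have WE : W = \sum_(0 <= n <oo) (c n)%:E * mu (F n).
  rewrite /W integral_nneseries//; apply: eq_eseriesr => n _.
  under eq_integral do rewrite EFinM.
  rewrite ge0_integralZl//.
  - by rewrite integral_indic// setIT.
  - exact/measurable_EFinP/measurable_indic.
  - by rewrite lee_fin ltW.
have W1 : W <= 1.
  rewrite WE; apply: le_trans geo; apply: lee_nneseries => // n _.
    by rewrite mule_ge0// lee_fin ltW.
  have Ffin : mu (F n) \is a fin_num by rewrite ge0_fin_numE//; exact: Foo.
  rewrite -[X in _ * X](fineK Ffin) -EFinM lee_fin /c.
  by rewrite mulrAC ler_pdivrMr ?ltr_pwDl// ler_wpM2l ?lerDr//; exact: ltW.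
have W0 : 0 < W.
  rewrite lt0e integral_ge0 ?andbT; last by move=> x _; rewrite ltW.
  apply: contra muT => /eqP W0; rewrite TF.
  have muF n : mu (F n) = 0.
    have : (c n)%:E * mu (F n) <= 0.
      rewrite -W0 WE (@nneseriesD1 _ _ n)//; last first.
        by move=> k _; rewrite mule_ge0// lee_fin ltW.
      by rewrite leeDl// nneseries_ge0// => k _ _; rewrite mule_ge0// lee_fin ltW.
    by rewrite pmule_rle0 ?lte_fin// measure_le0 => /eqP.
  apply/eqP/negligibleP; first exact: bigcupT_measurable.
  by apply: negligible_bigcup => n; apply/negligibleP; [exact: mF|exact: muF].
have Wfin : W \is a fin_num.
  by rewrite ge0_fin_numE ?(le_lt_trans W1) ?ltry// ltW.
have fW0 : (0 < fine W)%R by rewrite fine_gt0// W0 (le_lt_trans W1) ?ltry.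
pose w x := (fine (g x) / fine W)%R.
have mw : measurable_fun setT w.
  by apply: measurable_funM => //; exact: measurableT_comp.
have w0 x : (0 < w x)%R.
  by rewrite divr_gt0// fine_gt0// g0 (le_lt_trans (g1 x)) ?ltry.
have wi : \int[mu]_x (w x)%:E = 1.
  rewrite /w; under eq_integral => x _ do rewrite mulrC EFinM fineK//.
  rewrite ge0_integralZl//; last 2 first.
  - by move=> x _; exact: ltW.
  - by rewrite lee_fin invr_ge0 ltW.
  by rewrite -/W -{2}(fineK Wfin) -EFinM mulVf// gt_eqF.
have [m mE] := density_probability mw (fun x => ltW (w0 x)) wi.
by exists m, w; split=> //; split=> // x; exact: ltW.
Qed.

End domination.

Section quadratic_mean.
Local Open Scope ereal_scope.
Context d (T : measurableType d) (R : realType).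

Definition qmd_error (mu : set T -> \bar R) (p p0 s : T -> R) (h : R) : \bar R :=
  \int[mu]_u ((Num.sqrt (p u) - Num.sqrt (p0 u)
               - h / 2 * s u * Num.sqrt (p0 u)) ^+ 2)%:E.

Lemma measurable_sqrt_comp (p : T -> R) : measurable_fun setT p ->
  measurable_fun setT (fun u => Num.sqrt (p u)).
Proof.
move=> mp; apply: (measurableT_comp (f := @Num.sqrt R)) mp.
by apply: continuous_measurable_fun; exact: sqrt_continuous.
Qed.

Lemma measurable_inv_comp (p : T -> R) : (forall u, (0 <= p u)%R) ->
  measurable_fun setT p -> measurable_fun setT (fun u => (p u)^-1)%R.
Proof.
move=> p0 mp; under eq_fun do rewrite -powR_inv1//.
by apply: (measurableT_comp (f := fun x : R => (x `^ (-1))%R)) mp; exact: measurable_powR.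
Qed.

Lemma measurable_qmd_error (p p0 s : T -> R) (h : R) :
  measurable_fun setT p -> measurable_fun setT p0 -> measurable_fun setT s ->
  measurable_fun setT (fun u => (Num.sqrt (p u) - Num.sqrt (p0 u)
               - h / 2 * s u * Num.sqrt (p0 u))%R).
Proof.
move=> mp mp0 ms; apply: measurable_funB.
  by apply: measurable_funB; exact: measurable_sqrt_comp.
apply: measurable_funM; last exact: measurable_sqrt_comp.
exact: measurable_funM.
Qed.

(** The integrand is the square of an expression of degree one in the roots of the densities:
    dividing the densities by [w] divides the integrand by [w], and the change of measure restores
    this factor. *)
Lemma qmd_error_density (mu : {measure set T -> \bar R}) (m : probability T R)
    (w p p0 s : T -> R) h :
  is_density mu m w -> (forall u, (0 < w u)%R) ->
  measurable_fun setT p -> measurable_fun setT p0 -> measurable_fun setT s ->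
  (forall u, (0 <= p u)%R) -> (forall u, (0 <= p0 u)%R) ->
  qmd_error m (fun u => p u / w u)%R (fun u => p0 u / w u)%R s h
  = qmd_error mu p p0 s h.
Proof.
move=> [mw w0 wE] w_gt0 mp mp0 ms p_ge0 p0_ge0; rewrite /qmd_error.
have mV := measurable_inv_comp w0 mw.
rewrite (ge0_integral_density mw w0 wE)//; last 2 first.
- apply/measurable_EFinP/measurable_funX/measurable_qmd_error => //;
    exact: measurable_funM.
- by move=> u; rewrite lee_fin sqr_ge0.
apply: eq_integral => u _; rewrite -EFinM; congr EFin.
rewrite !sqrtrM// -[in X in (_ * X)%R](sqr_sqrtr (w0 u)) -exprMn.
congr (_ ^+ 2)%R; rewrite sqrtrV//.
have sw : Num.sqrt (w u) != 0%R by rewrite sqrtr_eq0 -ltNge.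
by field.
Qed.

(** A dominating probability can be pushed forward to X, or extended by a kernel to X * Y, and
    remains a probability. *)
Lemma is_score_probability (I : set R) (t0 : R) (P : R -> probability T R)
    (s : T -> R) : open I -> I t0 -> is_score I t0 P s ->
  exists (m : probability T R) (p : R -> T -> R),
    (forall t, I t -> is_density m (P t) (p t)) /\
    qmd_error m (p t) (p t0) s (t - t0) * ((t - t0) ^- 2)%:E
      @[t --> t0^'] --> 0.
Proof.
move=> oI It0 [[/Lfun2_measurable ms _] [mu [p [pd cvg0]]]].
have [mp0 p00 p0E] := pd _ It0.
have muT : mu setT != 0.
  apply/eqP => muT0; have := p0E setT measurableT.
  rewrite probability_setT null_set_integral//; last exact/measurable_EFinP.
  by case=> /eqP; rewrite oner_eq0.
have [m [w [mw w0]]] := sigma_finite_equivalent_probability muT.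
have [mw1 w1 wE] := mw.
have mV := measurable_inv_comp w1 mw1.
exists m, (fun t u => p t u / w u)%R; split.
  move=> t It; have [mp pt0 pE] := pd _ It; split.
  - exact: measurable_funM.
  - by move=> u; rewrite divr_ge0.
  move=> A mA; rewrite pE// [RHS]integral_mkcond.
  rewrite (ge0_integral_density mw1 w1 wE); last 2 first.
  - rewrite -(measurable_restrictT _ mA); apply/measurable_EFinP/measurable_funTS.
    exact: measurable_funM.
  - by move=> u; rewrite patchE; case: ifP => // _; rewrite lee_fin divr_ge0.
  rewrite [LHS]integral_mkcond; apply: eq_integral => u _; rewrite !patchE.
  by case: ifP => _; rewrite ?mul0e// -EFinM mulfVK// gt_eqF.
apply: cvg_trans cvg0; apply: near_eq_cvg.
have : \forall t \near t0^', I t.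
  by apply: nbhs_dnbhs; exact: open_nbhs_nbhs.
apply: filterS => t It; have [mp pt0 pE] := pd _ It.
by rewrite (qmd_error_density _ mw).
Qed.

End quadratic_mean.

Ltac meas := intros; solve [meas_rec]
with meas_rec := first [ assumption | lazymatch goal with
  | |- measurable_fun _ (cst _) => exact: measurable_cst
  | |- measurable_fun _ (fun=> ?c) => exact: measurable_cst
  | |- measurable_fun _ \1_ _ => exact: measurable_indic
  | |- measurable_fun _ (EFin \o _) => apply/measurable_EFinP; meas_rec
  | |- measurable_fun _ (fun z => (@?f z)%:E) => apply/measurable_EFinP; meas_rec
  | |- measurable_fun _ (fun z => Num.sqrt (@?f z)) =>
      apply: measurable_sqrt_comp; meas_rec
  | |- measurable_fun _ (fun z => @?f z ^+ _)%R => apply: measurable_funX; meas_rec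
  | |- measurable_fun _ (fun z => @?f z - @?g z)%R => apply: measurable_funB; meas_rec
  | |- measurable_fun _ (fun z => @?f z + @?g z)%R => apply: measurable_funD; meas_rec
  | |- measurable_fun _ (fun z => @?f z * @?g z)%R => apply: measurable_funM; meas_rec
  | |- measurable_fun _ (fun z => ?h (fst z)) =>
      apply: (measurableT_comp (f := h)); [meas_rec|exact: measurable_fst]
  end ].

Ltac nonneg := intros; rewrite /= ?lee_fin; solve [nonneg_rec]
with nonneg_rec := first
  [ exact: sqr_ge0 | exact: sqrtr_ge0 | exact: normr_ge0 | exact: ler0n | by auto
  | apply: mulr_ge0; nonneg_rec | apply: addr_ge0; nonneg_rec
  | rewrite invr_ge0; nonneg_rec ].

(** * Marginals and the Hellinger distance *)

Section marginal_theory.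
Local Open Scope ereal_scope.
Context dX dY (X : measurableType dX) (Y : measurableType dY) (R : realType).
Implicit Type P : probability (X * Y)%type R.

Lemma ge0_integral_marginal P (f : X -> \bar R) : measurable_fun setT f ->
  (forall x, 0 <= f x) -> \int[marginal P]_x f x = \int[P]_z f z.1.
Proof.
move=> mf f0; rewrite /marginal /distribution ge0_integral_pushforward//.
Qed.

(** A null set of the marginal of [m] has an [m]-null preimage, which is also [P]-null; the theorem
    of Radon and Nikodym applies. *)
Lemma marginal_density P (m : probability (X * Y)%type R) p :
  is_density m P p -> exists q, is_density (marginal m) (marginal P) q.
Proof.
move=> [mp p0 pE].
have dom : marginal P `<< marginal m.
  apply/null_content_dominatesP => A mA mA0.
  have mA' : measurable (fst @^-1` A : set (X * Y)).
    by rewrite -[X in measurable X]setTI; exact: measurable_fst.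
  rewrite -[LHS]/(P (fst @^-1` A)) (pE _ mA') null_set_integral//.
  exact/measurable_funTS/measurable_EFinP.
have [q [q0 qfin qi qE]] := radon_nikodym_sigma_finite dom.
exists (fine \o q); split.
- apply: measurableT_comp => //; exact: measurable_int qi.
- by move=> x; rewrite fine_ge0.
- move=> A mA; rewrite qE//; apply: eq_integral => x _.
  by rewrite /= fineK.
Qed.

(* The Hellinger affinity does not decrease under marginalization: 2 sqrt (F G) is at
   most c F + G / c, and c = sqrt (b / a) only depends on x. *)
Lemma hellinger_contraction (m : probability (X * Y)%type R) (F G : X * Y -> R)
    (nu : {measure set X -> \bar R}) (a b : X -> R) :
  measurable_fun setT F -> measurable_fun setT G ->
  measurable_fun setT a -> measurable_fun setT b ->
  (forall z, (0 <= F z)%R) -> (forall z, (0 <= G z)%R) ->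
  (forall x, (0 <= a x)%R) -> (forall x, (0 <= b x)%R) ->
  \int[m]_z (F z)%:E < +oo -> \int[m]_z (G z)%:E < +oo ->
  (forall h : X -> R, measurable_fun setT h -> (forall x, (0 <= h x)%R) ->
    \int[m]_z (h z.1 * F z)%:E = \int[nu]_x (h x * a x)%:E) ->
  (forall h : X -> R, measurable_fun setT h -> (forall x, (0 <= h x)%R) ->
    \int[m]_z (h z.1 * G z)%:E = \int[nu]_x (h x * b x)%:E) ->
  \int[nu]_x ((Num.sqrt (a x) - Num.sqrt (b x)) ^+ 2)%:E <=
  \int[m]_z ((Num.sqrt (F z) - Num.sqrt (G z)) ^+ 2)%:E.
Proof.
move=> mF mG ma mb F0 G0 a0 b0 iF iG hF hG.
pose sa x := Num.sqrt (a x); pose sb x := Num.sqrt (b x).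
have msa : measurable_fun setT sa by exact: measurable_sqrt_comp.
have msb : measurable_fun setT sb by exact: measurable_sqrt_comp.
have msF : measurable_fun setT (fun z => Num.sqrt (F z)) by exact: measurable_sqrt_comp.
have msG : measurable_fun setT (fun z => Num.sqrt (G z)) by exact: measurable_sqrt_comp.
have h1 (H : X * Y -> R) (e : X -> R) :
    (forall h : X -> R, measurable_fun setT h -> (forall x, (0 <= h x)%R) ->
      \int[m]_z (h z.1 * H z)%:E = \int[nu]_x (h x * e x)%:E) ->
    \int[m]_z (H z)%:E = \int[nu]_x (e x)%:E.
  move=> hH; transitivity (\int[m]_z (1 * H z)%:E).
    by apply: eq_integral => z _; rewrite mul1r.
  rewrite (hH (fun=> 1%R))//; apply: eq_integral => x _; by rewrite mul1r.
have hF1 := h1 _ _ hF; have hG1 := h1 _ _ hG.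
have mpr d (T : measurableType d) (f g : T -> R) : measurable_fun setT f ->
    measurable_fun setT g -> measurable_fun setT (fun z => (2 * (f z * g z))%R%:E : \bar R).
  by meas.
have msq d (T : measurableType d) (f g : T -> R) : measurable_fun setT f ->
    measurable_fun setT g -> measurable_fun setT (fun z => ((f z - g z) ^+ 2)%R%:E : \bar R).
  by meas.
(* The squared Hellinger distance plus twice the affinity is the sum of the masses. The identity
   avoids subtraction, as the integrals are extended reals. *)
have split_sq d (T : measurableType d) (k : {measure set T -> \bar R}) (f g : T -> R) :
    measurable_fun setT f -> measurable_fun setT g ->
    (forall z, (0 <= f z)%R) -> (forall z, (0 <= g z)%R) ->
    \int[k]_z ((Num.sqrt (f z) - Num.sqrt (g z)) ^+ 2)%:E +
    \int[k]_z (2 * (Num.sqrt (f z) * Num.sqrt (g z)))%:E =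
    \int[k]_z (f z)%:E + \int[k]_z (g z)%:E.
  move=> mf mg f0 g0.
  have msf := measurable_sqrt_comp mf; have msg := measurable_sqrt_comp mg.
  have mf' : measurable_fun setT (EFin \o f) by exact/measurable_EFinP.
  have mg' : measurable_fun setT (EFin \o g) by exact/measurable_EFinP.
  rewrite -!ge0_integralD//; try (by nonneg); try (by meas).
  apply: eq_integral => z _; rewrite -!EFinD; congr EFin.
  rewrite -[in RHS](sqr_sqrtr (f0 z)) -[in RHS](sqr_sqrtr (g0 z)); ring.
have key : \int[m]_z (2 * (Num.sqrt (F z) * Num.sqrt (G z)))%:E <=
    \int[nu]_x (2 * (sa x * sb x))%:E.
  pose c x := (sb x / sa x)%R; pose c' x := (sa x / sb x)%R.
  have mc : measurable_fun setT c.
    by apply: measurable_funM => //; apply: measurable_inv_comp => // x; exact: sqrtr_ge0.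
  have mc' : measurable_fun setT c'.
    by apply: measurable_funM => //; apply: measurable_inv_comp => // x; exact: sqrtr_ge0.
  have c0 x : (0 <= c x)%R by apply: divr_ge0; exact: sqrtr_ge0.
  have c'0 x : (0 <= c' x)%R by apply: divr_ge0; exact: sqrtr_ge0.
  have mcF : measurable_fun setT (fun z : X * Y => (c z.1 * F z)%R).
    by apply: measurable_funM => //; apply: measurableT_comp.
  have mcG : measurable_fun setT (fun z : X * Y => (c' z.1 * G z)%R).
    by apply: measurable_funM => //; apply: measurableT_comp.
  (* Where [a] or [b] vanishes, [c] and [c'] are both 0, division by 0 being 0, so the bound
     requires F or G to vanish there too. Testing the hypothesis with the indicator of {e = 0} shows
     this almost everywhere. *)
  have vanish (H : X * Y -> R) (e : X -> R) : measurable_fun setT H ->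
      measurable_fun setT e -> (forall z, (0 <= H z)%R) ->
      (forall h : X -> R, measurable_fun setT h -> (forall x, (0 <= h x)%R) ->
        \int[m]_z (h z.1 * H z)%:E = \int[nu]_x (h x * e x)%:E) ->
      {ae m, forall z, e z.1 = 0%R -> H z = 0%R}.
    move=> mH me H0 hH.
    have mA : measurable (e @^-1` [set 0%R]).
      by rewrite -[X in measurable X]setTI; exact: me.
    have := hH \1_(e @^-1` [set 0%R]) (measurable_indic mA) (fun x => ltac:(by [])).
    rewrite [RHS]integral0_eq; last first.
      move=> x _; rewrite indicE; case: (boolP (x \in _)); rewrite ?mul0r//.
      by rewrite inE /= => ->; rewrite mulr0.
    have m1 : measurable_fun setT (fun z : X * Y => \1_(e @^-1` [set 0%R]) z.1 * H z)%R.
      by apply: measurable_funM => //; apply: measurableT_comp => //; exact: measurable_indic.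
    move=> int0; have : \int[m]_z `|(\1_(e @^-1` [set 0%R]) z.1 * H z)%:E| = 0.
      by rewrite -int0; apply: eq_integral => z _; rewrite gee0_abs// lee_fin mulr_ge0.
    move=> /(ae_eq_integral_abs _ measurableT (measurableT_comp _ m1)).
    move=> /(_ ltac:(exact: EFin_measurable)).
    move=> h0; apply: filterS h0 => z /(_ I) /= + ez; rewrite indicE mem_set//= mul1r.
    by case.
  have ae_le : {ae m, forall z, (2 * (Num.sqrt (F z) * Num.sqrt (G z)) <=
                                 c z.1 * F z + c' z.1 * G z)%R}.
    have := vanish _ _ mF ma F0 hF; have := vanish _ _ mG mb G0 hG.
    apply: filterS2 => z Gz Fz.
    have [a00|an0] := eqVneq (a z.1) 0%R.
      rewrite (Fz a00) sqrtr0 mul0r !mulr0 add0r mulr_ge0//.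
    have [b00|bn0] := eqVneq (b z.1) 0%R.
      rewrite (Gz b00) sqrtr0 !mulr0 addr0 mulr_ge0//.
    have sap : (0 < sa z.1)%R by rewrite sqrtr_gt0 lt0r an0 a0.
    have sbp : (0 < sb z.1)%R by rewrite sqrtr_gt0 lt0r bn0 b0.
    rewrite -[in leRHS](sqr_sqrtr (F0 z)) -[in leRHS](sqr_sqrtr (G0 z)).
    rewrite /c /c' -subr_ge0.
    set f := Num.sqrt (F z); set g := Num.sqrt (G z).
    rewrite (_ : (_ - _)%R = ((sb z.1 * f - sa z.1 * g) ^+ 2 / (sa z.1 * sb z.1))%R).
      by rewrite divr_ge0 ?sqr_ge0// ltW// mulr_gt0.
    by field; rewrite !gt_eqF.
  apply: (@le_trans _ _ (\int[m]_z (c z.1 * F z + c' z.1 * G z)%:E)).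
    apply: ae_ge0_le_integral => //; try (by nonneg); try (by meas).
    by apply: filterS ae_le => z h _; rewrite lee_fin.
  rewrite [leLHS](_ : _ = \int[m]_z ((c z.1 * F z)%:E + (c' z.1 * G z)%:E))//.
  rewrite ge0_integralD//; try (by nonneg); try (by meas).
  rewrite hF// hG// -ge0_integralD//; try (by nonneg); try (by meas).
  rewrite le_eqVlt; apply/orP; left; apply/eqP; apply: eq_integral => x _.
  rewrite -EFinD; congr EFin; rewrite /c /c'.
  rewrite -[a x](sqr_sqrtr (a0 x)) -[b x](sqr_sqrtr (b0 x)) -/(sa x) -/(sb x).
  have [->|an0] := eqVneq (sa x) 0%R; first by rewrite !(mul0r,mulr0,invr0,expr0n,addr0).
  have [->|bn0] := eqVneq (sb x) 0%R; first by rewrite !(mul0r,mulr0,invr0,expr0n,addr0).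
  by field; rewrite an0 bn0.
have SN := split_sq _ _ nu a b ma mb a0 b0.
have SM := split_sq _ _ m F G mF mG F0 G0.
rewrite -hF1 -hG1 -SM in SN.
(* Finiteness is needed to cancel the affinity of the marginals from both sides. *)
have fin : \int[nu]_x (2 * (sa x * sb x))%:E \is a fin_num.
  have : \int[nu]_x (2 * (sa x * sb x))%:E <= \int[m]_z (F z)%:E + \int[m]_z (G z)%:E.
    rewrite -SM -SN leeDr// integral_ge0// => x _; rewrite lee_fin sqr_ge0//.
  move=> /le_lt_trans h; rewrite ge0_fin_numE; first by apply: h; exact: lte_add_pinfty.
  by apply: integral_ge0; rewrite /sa /sb; nonneg.
rewrite -(leeD2rE _ _ fin) SN.
exact: leeD2l.
Qed.

End marginal_theory.

(** * Conditional means under a kernel *)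

Section square_integrable_measure.
Local Open Scope ereal_scope.
Context d (T : measurableType d) (R : realType).
Variables (k : {measure set T -> \bar R}).
Hypothesis k1 : k setT = 1.

Lemma integrable_cst1 (c : R) : k.-integrable setT (fun=> c%:E).
Proof.
apply/integrableP; split; first exact: measurable_cst.
by rewrite integral_cst//= k1 mule1 ltry.
Qed.

Lemma sqr_integrable (f : T -> R) : measurable_fun setT f ->
  \int[k]_x (f x ^+ 2)%:E < +oo ->
  k.-integrable setT (fun x => (f x)%:E) /\
  k.-integrable setT (fun x => (f x ^+ 2)%:E).
Proof.
move=> mf f2; have i2 : k.-integrable setT (fun x => (f x ^+ 2)%:E).
  apply/integrableP; split; first by meas.
  by under eq_integral do rewrite gee0_abs ?lee_fin ?sqr_ge0//.
split=> //; apply: (@le_integrable _ _ _ _ _ _ _ (fun x => (1 + f x ^+ 2)%:E)) => //.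
- by meas.
- move=> x _; rewrite !abse_EFin lee_fin [leRHS]ger0_norm ?addr_ge0 ?sqr_ge0//.
  rewrite -(real_normK (num_real (f x))).
  have := sqr_ge0 (`|f x| - 1)%R; have := normr_ge0 (f x); nra.
- under eq_fun do rewrite EFinD.
  by apply: integrableD => //; exact: integrable_cst1.
Qed.

Lemma integral_sqr_affine (f : T -> R) (a b : R) : measurable_fun setT f ->
  \int[k]_x (f x ^+ 2)%:E < +oo ->
  \int[k]_x ((b + a * f x) ^+ 2)%:E =
  (b ^+ 2 + 2 * a * b * fine (\int[k]_x (f x)%:E)
   + a ^+ 2 * fine (\int[k]_x (f x ^+ 2)%:E))%:E.
Proof.
move=> mf f2; have [i1 i2] := sqr_integrable mf f2.
have E x : ((b + a * f x) ^+ 2)%:E =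
    (b ^+ 2)%:E + ((2 * a * b)%:E * (f x)%:E + (a ^+ 2)%:E * (f x ^+ 2)%:E).
  by rewrite -!EFinM -!EFinD; congr EFin; ring.
under eq_integral do rewrite E.
have i1' := @integrableZl _ _ _ k setT measurableT (2 * a * b)%R _ i1.
have i2' := @integrableZl _ _ _ k setT measurableT (a ^+ 2)%R _ i2.
rewrite integralD//; [|exact: integrable_cst1|exact: integrableD].
rewrite integralD// !integralZl// integral_cst//= k1 mule1.
rewrite -[in LHS](fineK (integrable_fin_num measurableT i1)).
by rewrite -[in LHS](fineK (integrable_fin_num measurableT i2)) -!EFinM -!EFinD addrA.
Qed.

(** The integral of (f - s)^2, with s the mean of f, is nonnegative. The measure is only assumed to
    have mass 1, so that it can be a value [K x] of a kernel. *)
Lemma sqr_integral_le (f : T -> R) : measurable_fun setT f ->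
  \int[k]_x (f x ^+ 2)%:E < +oo ->
  (fine (\int[k]_x (f x)%:E) ^+ 2 <= fine (\int[k]_x (f x ^+ 2)%:E))%R.
Proof.
move=> mf f2; set s := fine (\int[k]_x (f x)%:E).
have : 0 <= \int[k]_x ((- s + 1 * f x) ^+ 2)%:E.
  by apply: integral_ge0 => x _; rewrite lee_fin sqr_ge0.
rewrite (integral_sqr_affine _ _ mf f2) lee_fin -/s; nra.
Qed.

End square_integrable_measure.

Section kernel_mean.
Local Open Scope ereal_scope.
Context dX dY (X : measurableType dX) (Y : measurableType dY) (R : realType).

(** A version of E[f | X = x]. Where the integral is infinite, [fine] returns 0, so the usual rules
    hold only almost everywhere. *)
Definition kmean (K : R.-pker X ~> Y) (f : X * Y -> R) (x : X) : R :=
  fine (\int[K x]_y (f (x, y))%:E).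

Lemma integral_section_posneg (K : R.-pker X ~> Y) (g : X * Y -> R) x :
  \int[K x]_y (g (x, y))%:E =
  \int[K x]_y (EFin \o g)^\+ (x, y) - \int[K x]_y (EFin \o g)^\- (x, y).
Proof.
rewrite integralE; congr (_ - _); apply: eq_integral => y _.
- by rewrite !funeposE.
- by rewrite !funenegE.
Qed.

Lemma measurable_kmean (K : R.-pker X ~> Y) f : measurable_fun setT f ->
  measurable_fun setT (kmean K f).
Proof.
move=> mf; apply: measurableT_comp => //.
have mf' : measurable_fun setT (EFin \o f) by exact/measurable_EFinP.
under eq_fun do rewrite integral_section_posneg.
apply: emeasurable_funB.
- exact: (measurable_ksection K (measurable_funepos mf') (funepos_ge0 _)).
- exact: (measurable_ksection K (measurable_funeneg mf') (funeneg_ge0 _)).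
Qed.

Variables (P0 : probability (X * Y)%type R) (Q0 : probability X R)
  (K : R.-pker X ~> Y).
Hypothesis P0E : forall A, measurable A -> P0 A = joint Q0 K A.

Lemma ae_section_lty (f : X * Y -> \bar R) : measurable_fun setT f ->
  (forall z, 0 <= f z) -> \int[P0]_z f z < +oo ->
  {ae Q0, forall x, \int[K x]_y f (x, y) < +oo}.
Proof.
move=> mf f0; rewrite (ge0_integral_joint P0E)// => fi.
have i : Q0.-integrable setT (fun x => \int[K x]_y f (x, y)).
  apply/integrableP; split; first exact: measurable_ksection.
  by under eq_integral do rewrite gee0_abs ?integral_ge0//.
have := integrable_ae measurableT i; apply: filterS => x /(_ I).
by rewrite ge0_fin_numE// integral_ge0.
Qed.

Lemma ae_section_integrable (g : X * Y -> R) :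
  P0.-integrable setT (EFin \o g) ->
  {ae Q0, forall x, (K x).-integrable setT (fun y => (g (x, y))%:E)}.
Proof.
move=> /integrableP[mg ig].
have mag : measurable_fun setT (fun z => `|(g z)%:E|) by exact: measurableT_comp.
have := ae_section_lty mag (fun z => abse_ge0 _) ig.
apply: filterS => x ix; apply/integrableP; split=> //.
exact: (measurable_fun_section x mg).
Qed.

Lemma integral_kmean (g : X * Y -> R) : P0.-integrable setT (EFin \o g) ->
  Q0.-integrable setT (EFin \o kmean K g) /\
  \int[P0]_z (g z)%:E = \int[Q0]_x (kmean K g x)%:E.
Proof.
move=> ig; have mg := measurable_int _ ig.
have ip := integrable_funepos measurableT ig.
have im := integrable_funeneg measurableT ig.
have mp := measurable_int _ ip; have mm := measurable_int _ im.
pose a x := \int[K x]_y (EFin \o g)^\+ (x, y).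
pose b x := \int[K x]_y (EFin \o g)^\- (x, y).
have part (f : X * Y -> \bar R) : P0.-integrable setT f -> (forall z, 0 <= f z) ->
    Q0.-integrable setT (fun x => \int[K x]_y f (x, y)).
  move=> /integrableP[mf fi] f0; apply/integrableP; split.
    exact: measurable_ksection.
  under eq_integral do rewrite gee0_abs ?integral_ge0//.
  rewrite -(ge0_integral_joint P0E)//; apply: le_lt_trans fi.
  by under [leRHS]eq_integral do rewrite gee0_abs//.
have ia : Q0.-integrable setT a by apply: part => // z; exact: funepos_ge0.
have ib : Q0.-integrable setT b by apply: part => // z; exact: funeneg_ge0.
(* Both parts are finite only almost everywhere; there [fine] loses nothing. *)
have abE : {ae Q0, forall x, setT x -> a x - b x = (kmean K g x)%:E}.
  have := ae_section_integrable ig; apply: filterS => x ix _.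
  rewrite /kmean fineK; last exact: (integrable_fin_num measurableT ix).
  by rewrite integral_section_posneg.
have mk : measurable_fun setT (EFin \o kmean K g).
  by apply/measurable_EFinP/measurable_kmean/measurable_EFinP.
have iab : Q0.-integrable setT (fun x => a x - b x) by exact: integrableB.
split.
  apply/integrableP; split=> //; have /integrableP[mab] := iab.
  congr (_ < _); apply: ae_eq_integral => //.
  - exact: measurableT_comp.
  - exact: measurableT_comp.
  - by apply: filterS abE => x h _; rewrite /= h.
have Ep := ge0_integral_joint P0E mp (funepos_ge0 _).
have Em := ge0_integral_joint P0E mm (funeneg_ge0 _).
rewrite integralE [X in X - _]Ep [X in _ - X]Em.
rewrite -integralB//.
apply: ae_eq_integral => //; exact: measurable_int iab.
Qed.

Lemma ae_kmeanM_fst (h : X -> R) (g : X * Y -> R) :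
  P0.-integrable setT (EFin \o g) ->
  {ae Q0, forall x, kmean K (fun z => h z.1 * g z)%R x = (h x * kmean K g x)%R}.
Proof.
move=> /ae_section_integrable; apply: filterS => x ix.
rewrite /kmean /=; under eq_integral do rewrite EFinM.
by rewrite integralZl// fineM// integrable_fin_num.
Qed.

(** Conditional Jensen inequality: on almost every fibre, the square of the mean is at most the mean
    of the square. *)
Lemma Lfun2_kmean (f : X * Y -> R) : f \in Lfun P0 2%:E ->
  {ae Q0, forall x, \int[K x]_y (f (x, y) ^+ 2)%:E < +oo} /\
  kmean K f \in Lfun Q0 2%:E.
Proof.
move=> /Lfun2P[mf f2].
have h : {ae Q0, forall x, \int[K x]_y (f (x, y) ^+ 2)%:E < +oo}.
  have := @ae_section_lty (fun z => (f z ^+ 2)%:E); apply => //.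
    by meas.
  by nonneg.
split=> //; apply/Lfun2P; split; first exact: measurable_kmean.
apply: le_lt_trans f2.
rewrite (ge0_integral_joint P0E)//; try (by nonneg); try (by meas).
apply: ae_ge0_le_integral => //; try (by nonneg).
- by apply/measurable_EFinP/measurable_funX/measurable_kmean.
- by move=> x _; apply: integral_ge0; nonneg.
- by apply: (measurable_ksection K (f := fun z => (f z ^+ 2)%:E)); [meas|nonneg].
apply: filterS h => x fx _.
have mfx := measurable_fun_section x (f := EFin \o f) ltac:(by apply/measurable_EFinP).
rewrite -(@fineK _ (\int[K x]_y _)); last first.
  by rewrite ge0_fin_numE// integral_ge0//; nonneg.
rewrite lee_fin; apply: sqr_integral_le => //; first exact: prob_kernel.
exact/measurable_EFinP.
Qed.

End kernel_mean.

(** * Quadratic mean expansion of the root of the marginal density *)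

Section square_root_expansion.
Context (R : realType).

(** To be used with a = h sigma / 2 and b = (h / 2)^2 v. The first bound is of order h^2 and gives
    domination; the second is of order h^4 and gives pointwise convergence after division by h^2.
    The constants are not sharp. *)
Lemma sqrt_expansion (a b : R) : a ^+ 2 <= b ->
  (Num.sqrt (1 + 2 * a + b) - (1 + a)) ^+ 2 <= 9 * b /\
  (Num.sqrt (1 + 2 * a + b) - (1 + a)) ^+ 2 <= 36 * b ^+ 2.
Proof.
move=> ab; set r := Num.sqrt _.
have r0 : 0 <= r by exact: sqrtr_ge0.
have r2 : r ^+ 2 = 1 + 2 * a + b.
  by rewrite sqr_sqrtr//; have := sqr_ge0 (1 + a); nra.
have b0 : 0 <= b by apply: le_trans ab; exact: sqr_ge0.
(* If 1 + a is nonnegative, it is at most r, and the product of r - (1 + a) and r + (1 + a) is b -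
   a^2. Otherwise a < -1, hence b > 1, and a crude bound gives both estimates. *)
have [a1|a1] := leP 0 (1 + a).
  have rle : 1 + a <= r.
    rewrite -ler_sqr ?nnegrE// r2; nra.
  have E : (r - (1 + a)) * (r + (1 + a)) = b - a ^+ 2.
    by rewrite -subr_sqr r2; ring.
  have D1 : (r - (1 + a)) ^+ 2 <= b.
    have : (r - (1 + a)) ^+ 2 <= (r - (1 + a)) * (r + (1 + a)).
      by rewrite expr2 ler_wpM2l ?subr_ge0//; lra.
    by rewrite E; have := sqr_ge0 a; lra.
  split; first by lra.
  (* For b at most 1/4, a is at least -1/2, so r + (1 + a) is at least 1 and r - (1 + a) is at most
     b. For larger b, the first bound implies the second, since b <= 4 b^2. *)
  have [b4|b4] := leP b (4^-1).
    have a2 : -2^-1 <= a.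
      rewrite leNgt; apply/negP => ha; nra.
    have D2 : r - (1 + a) <= b.
      have : (r - (1 + a)) * 1 <= (r - (1 + a)) * (r + (1 + a)).
        by rewrite ler_wpM2l ?subr_ge0//; lra.
      by rewrite E mulr1; have := sqr_ge0 a; lra.
    have : (r - (1 + a)) ^+ 2 <= b ^+ 2 by rewrite ler_sqr ?nnegrE ?subr_ge0.
    have := sqr_ge0 b; lra.
  by apply: (le_trans D1); rewrite expr2; nra.
have D1 : (r - (1 + a)) ^+ 2 <= 9 * b.
  have : (r - (1 + a)) ^+ 2 <= 2 * r ^+ 2 + 2 * (1 + a) ^+ 2.
    by have := sqr_ge0 (r + (1 + a)); nra.
  rewrite r2; nra.
split=> //; apply: (le_trans D1); rewrite expr2.
have : 1 <= b by nra.
nra.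
Qed.

End square_root_expansion.

Section sqrt_remainder.
Local Open Scope ereal_scope.
Context d (T : measurableType d) (R : realType) (Q : probability T R).
Variables (sigma v : T -> R).
Hypotheses (msigma : measurable_fun setT sigma) (mv : measurable_fun setT v).
Hypotheses (v0 : forall x, (0 <= v x)%R) (iv : Q.-integrable setT (EFin \o v))
  (sigma_v : {ae Q, forall x, (sigma x ^+ 2 <= v x)%R}).

Let tau (h : R) x := (1 + h * sigma x + (h / 2) ^+ 2 * v x)%R.
Let rem (h : R) x := ((Num.sqrt (tau h x) - 1 - h / 2 * sigma x) ^+ 2)%R.

Let mrem h : measurable_fun setT (rem h).
Proof. by rewrite /rem /tau; meas. Qed.

Let rem_bound h x : (sigma x ^+ 2 <= v x)%R ->
  (rem h x <= h ^+ 2 * (9 / 4 * v x))%R /\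
  (rem h x <= h ^+ 4 * (9 / 4 * v x ^+ 2))%R.
Proof.
move=> sv; have ab : ((h / 2 * sigma x) ^+ 2 <= (h / 2) ^+ 2 * v x)%R.
  by rewrite exprMn ler_wpM2l// sqr_ge0.
have [] := sqrt_expansion ab.
have -> : (1 + 2 * (h / 2 * sigma x) + (h / 2) ^+ 2 * v x = tau h x)%R.
  by rewrite /tau; field.
have -> : ((Num.sqrt (tau h x) - (1 + h / 2 * sigma x)) ^+ 2 = rem h x)%R.
  by rewrite /rem opprD addrA.
move=> h1 h2; split.
  by apply: (le_trans h1); rewrite le_eqVlt; apply/orP; left; apply/eqP; field.
by apply: (le_trans h2); rewrite le_eqVlt; apply/orP; left; apply/eqP; field.
Qed.

(** Dominated convergence: after division by h^2, the remainder is at most 9/4 v, which is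
    integrable, and at most 9/4 h^2 v^2, which tends to 0 pointwise even if v^2 is not
    integrable. *)
Lemma cvg_sqrt_remainder (t0 : R) :
  (\int[Q]_x (rem (t - t0) x)%:E) * ((t - t0) ^- 2)%:E @[t --> t0^'] --> 0.
Proof.
pose F t := (\int[Q]_x (rem (t - t0) x)%:E) * ((t - t0) ^- 2)%:E.
have Fle t : t != t0 -> F t <= \int[Q]_x (9 / 4 * v x)%:E.
  move=> tt0; have h0 : (t - t0 != 0)%R by rewrite subr_eq0.
  rewrite /F muleC -ge0_integralZl//; try (by nonneg); try (by apply/measurable_EFinP/mrem).
  - apply: ae_ge0_le_integral => //; try (by meas).
    + by move=> x _; rewrite -EFinM lee_fin mulr_ge0 ?sqr_ge0// invr_ge0 sqr_ge0.
    + by apply: emeasurable_funM => //; apply/measurable_EFinP/mrem.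
    + by nonneg.
    + apply: filterS sigma_v => x /(rem_bound (t - t0))[+ _] _.
      move=> h1; rewrite -EFinM lee_fin mulrC ler_pdivrMr; last by rewrite exprn_even_gt0.
      by rewrite mulrC.
have iv9 : Q.-integrable setT (fun x => (9 / 4 * v x)%:E).
  exact: (@integrableZl _ _ _ Q setT measurableT (9 / 4)%R _ iv).
have Ffin t : t != t0 -> F t \is a fin_num.
  move=> tt0; rewrite ge0_fin_numE.
    apply: le_lt_trans (Fle _ tt0) _; exact: integrable_lty.
  by apply: mule_ge0; [apply: integral_ge0; nonneg|rewrite lee_fin invr_ge0 sqr_ge0].
apply/fine_cvgP; split.
  by near=> t; apply: Ffin; near: t; exact: nbhs_dnbhs_neq.
(* Dominated convergence is applied along an arbitrary sequence that tends to t0 and avoids it. *)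
apply/cvgr_dnbhsP => u [ut0 cu].
suff : F (u n) @[n --> \oo] --> 0 by move=> /fine_cvgP[].
pose f n x := ((u n - t0) ^- 2 * rem (u n - t0) x)%:E.
have FE n : F (u n) = \int[Q]_x f n x.
  by rewrite /F /f muleC -ge0_integralZl//; try (by nonneg); try (by apply/measurable_EFinP/mrem).
have f0 n x : 0 <= f n x.
  by rewrite lee_fin mulr_ge0 ?invr_ge0 ?sqr_ge0.
have [] := @dominated_convergence _ _ _ Q setT measurableT f (cst 0)
    (fun x => (9 / 4 * v x)%:E).
- by move=> n; apply/measurable_EFinP/measurable_funM.
- exact: measurable_cst.
- apply: filterS sigma_v => x sx _; have rb h := rem_bound h sx.
  apply: cvg_EFin; first by near=> n.
  apply: (@squeeze_cvgr _ _ _ _ (cst 0%R) (fun n => (u n - t0) ^+ 2 * (9 / 4 * v x ^+ 2))%R).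
  + near=> n; rewrite -lee_fin f0 /= mulrC ler_pdivrMr; last first.
      by rewrite exprn_even_gt0//= subr_eq0.
    have [_ h2] := rb (u n - t0)%R.
    by apply: (le_trans h2); rewrite le_eqVlt; apply/orP; left; apply/eqP; ring.
  + exact: cvg_cst.
  + rewrite -[X in _ --> X](mul0r (9 / 4 * v x ^+ 2)%R); apply: cvgMr_tmp => //.
    have c0 : (u n - t0)%R @[n --> \oo] --> (0 : R)%R.
      by rewrite -(subrr t0); exact: (cvgB cu (cvg_cst t0)).
    rewrite -[X in _ --> X](mulr0 (0 : R)%R); exact: (cvgM c0 c0).
- exact: iv9.
- apply: filterS sigma_v => x sx n _; have rb h := rem_bound h sx.
  rewrite gee0_abs// lee_fin mulrC ler_pdivrMr; last first.
    by rewrite exprn_even_gt0//= subr_eq0.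
  by have [h1 _] := rb (u n - t0)%R; rewrite mulrC.
move=> _ _; rewrite integral_cst// mul0e.
by under [X in X @ _ --> _]eq_fun do rewrite -FE.
Unshelve. all: by end_near. Qed.

End sqrt_remainder.

(** * Submodels with a fixed kernel, and marginal submodels *)

Section joint_submodels.
Local Open Scope ereal_scope.
Context dX dY (X : measurableType dX) (Y : measurableType dY) (R : realType).
Variables (K : R.-pker X ~> Y).

Lemma joint_marginal (P : probability (X * Y)%type R) (Q : probability X R) :
  (forall A, measurable A -> P A = joint Q K A) ->
  forall B, measurable B -> marginal P B = Q B.
Proof.
move=> PE B mB; rewrite -[LHS]/(P (fst @^-1` B)) PE; last first.
  by rewrite -[X in measurable X]setTI; exact: measurable_fst.
rewrite /joint -[Q B]/(Q B) -[in RHS](setIT B) -integral_indic//.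
apply: eq_integral => x _; rewrite indicE; case: (boolP (x \in B)) => xB.
  rewrite (_ : xsection _ x = setT) ?prob_kernel//.
  by apply/seteqP; split=> // y _; rewrite /xsection /= inE /=; exact: set_mem.
rewrite (_ : xsection _ x = set0) ?measure0//.
apply/seteqP; split=> // y; rewrite /xsection /= inE /= => xB'.
by move: xB; rewrite mem_set.
Qed.

Lemma joint_eq (Q Q' : {measure set X -> \bar R}) :
  (forall B, measurable B -> Q B = Q' B) -> forall A, joint Q K A = joint Q' K A.
Proof. by move=> QQ A; apply: eq_measure_integral => B mB _; rewrite QQ. Qed.

Lemma L20_eq_measure d (T : measurableType d) (P Q : probability T R) (f : T -> R) :
  (forall B, measurable B -> P B = Q B) -> L20 P f -> L20 Q f.
Proof.
move=> PQ [/Lfun2P[mf f2] f0]; split.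
  apply/Lfun2P; split=> //; rewrite -(@eq_measure_integral _ _ _ _ Q P)//.
  by move=> B mB _; exact: PQ.
move: f0; rewrite !expectation.unlock => <-; apply: eq_measure_integral => B mB _.
by apply/esym; exact: PQ.
Qed.

Lemma L20_comp_fst (P : probability (X * Y)%type R) (f : X -> R) :
  L20 (marginal P) f -> L20 P (fun z => f z.1).
Proof.
move=> [/[dup] fL /Lfun2P[mf f2] f0].
have fL2 : (fun z : X * Y => f z.1) \in Lfun P 2%:E.
  apply/Lfun2P; split; first by meas.
  rewrite -(ge0_integral_marginal P (f := fun x => (f x ^+ 2)%:E))//; [by meas|by nonneg].
split=> //; move: f0; rewrite !expectation.unlock => <-.
rewrite -[RHS]/(\int[pushforward P fst]_x (f x)%:E).
rewrite integral_pushforward//.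
- exact/measurable_EFinP.
- rewrite preimage_setT; apply/Lfun1_integrable.
  apply: (Lfun_subset12 (fin_num_measure P _ measurableT)) fL2.
Qed.

(** With a common kernel, the density of [P t] with respect to [joint nu K] is that of [Q t] with
    respect to [nu], read as a function of x. As the kernel has mass 1, the quadratic mean errors
    coincide. *)
Lemma joint_score (I : set R) (t0 : R) (Q : R -> probability X R)
    (P : R -> probability (X * Y)%type R) (sigma : X -> R) :
  open I -> I t0 ->
  (forall t, I t -> forall A, measurable A -> P t A = joint (Q t) K A) ->
  is_score I t0 Q sigma -> is_score I t0 P (fun z => sigma z.1).
Proof.
move=> oI It0 PE sQ; have [sL _] := sQ.
have ms : measurable_fun setT sigma by case: sL => /Lfun2P[].
split.
  apply: L20_comp_fst; apply: L20_eq_measure sL => B mB.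
  by rewrite (joint_marginal (PE _ It0)).
have [nu [q [qd cvgq]]] := is_score_probability oI It0 sQ.
have M0E A : measurable A -> joint_prob nu K A = joint nu K A by [].
exists (joint_prob nu K), (fun t z => q t z.1); split.
  move=> t It; have [mq q0 qE] := qd _ It; split; first by meas.
    by move=> z; exact: q0.
  move=> A mA; rewrite PE// /joint.
  rewrite (ge0_integral_density mq q0 qE)//; last exact: measurable_kxsection.
  rewrite [RHS]integral_mkcond (ge0_integral_joint M0E).
  - apply: eq_integral => x _; rewrite -ksection_indic// muleC -ge0_integralZl//.
    + apply: eq_integral => y _; rewrite patchE indicE.
      by case: (_ \in _); rewrite ?mule1 ?mule0.
    + apply: (measurable_fun_section x (f := fun z => (\1_A z)%:E)).
      exact/measurable_EFinP/measurable_indic.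
    + by rewrite lee_fin.
  - by rewrite -(measurable_restrictT _ mA); apply: measurable_funTS; meas.
  - by move=> z; rewrite patchE; case: ifP => // _; rewrite lee_fin.
apply: cvg_trans cvgq; apply: near_eq_cvg.
have : \forall t \near t0^', I t.
  by apply: nbhs_dnbhs; exact: open_nbhs_nbhs.
have [mq0 _ _] := qd _ It0.
apply: filterS => t It; have [mq _ _] := qd _ It.
congr (_ * _); rewrite /qmd_error.
rewrite [RHS](ge0_integral_joint M0E)//; try (by nonneg); try (by meas).
by apply: eq_integral => x _ /=; rewrite (integral_cst (K x) measurableT) prob_kernel mule1.
Qed.

End joint_submodels.

Section marginal_submodels.
Local Open Scope ereal_scope.
Context dX dY (X : measurableType dX) (Y : measurableType dY) (R : realType).
Variables (K : R.-pker X ~> Y) (I : set R) (t0 : R)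
  (P : R -> probability (X * Y)%type R) (s : X * Y -> R).
Hypotheses (oI : open I) (It0 : I t0).
Hypothesis P0E : forall A, measurable A ->
  P t0 A = joint (marginal (P t0)) K A.
Hypothesis score_s : is_score I t0 P s.

Let Q0 := marginal (P t0).
Let sigma := kmean K s.
Let v x := fine (\int[K x]_y (s (x, y) ^+ 2)%:E).
(** The density with respect to [Q0] of the marginal of (1 + h s / 2)^2 P t0. *)
Let tau (h : R) x := fine (\int[K x]_y ((1 + h / 2 * s (x, y)) ^+ 2)%:E).

Let ms : measurable_fun setT s.
Proof. by have [[/Lfun2P[]]] := score_s. Qed.

Let s2 : \int[P t0]_z (s z ^+ 2)%:E < +oo.
Proof. by have [[/Lfun2P[]]] := score_s. Qed.

Let msx x : measurable_fun setT (fun y => s (x, y)).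
Proof.
have : measurable_fun setT (EFin \o (fun y => s (x, y))); last first.
  by move/measurable_EFinP.
apply: (measurable_fun_section x (f := EFin \o s)); exact/measurable_EFinP.
Qed.

Let msigma : measurable_fun setT sigma.
Proof. exact: measurable_kmean. Qed.

Let mv : measurable_fun setT v.
Proof.
apply: measurableT_comp => //.
by apply: (measurable_ksection K (f := fun z => (s z ^+ 2)%:E)); [meas|nonneg].
Qed.

Let v0 x : (0 <= v x)%R.
Proof. by rewrite fine_ge0// integral_ge0//; nonneg. Qed.

Let mtau h : measurable_fun setT (tau h).
Proof.
apply: measurableT_comp => //.
by apply: (measurable_ksection K (f := fun z => ((1 + h / 2 * s z) ^+ 2)%:E)); [meas|nonneg].
Qed.

Let tau0 h x : (0 <= tau h x)%R.
Proof. by rewrite fine_ge0// integral_ge0//; nonneg. Qed.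

Let aev : {ae Q0, forall x, \int[K x]_y (s (x, y) ^+ 2)%:E < +oo}.
Proof. by have [[sL _] _] := score_s; have [] := Lfun2_kmean P0E sL. Qed.

Let sigma_v : {ae Q0, forall x, (sigma x ^+ 2 <= v x)%R}.
Proof.
by apply: filterS aev => x fx; apply: sqr_integral_le => //; exact: prob_kernel.
Qed.

Let tauE h : {ae Q0, forall x,
  \int[K x]_y ((1 + h / 2 * s (x, y)) ^+ 2)%:E = (tau h x)%:E /\
  tau h x = (1 + h * sigma x + (h / 2) ^+ 2 * v x)%R}.
Proof.
apply: filterS aev => x fx.
have K1 : K x setT = 1 by exact: prob_kernel.
have E := integral_sqr_affine K1 (h / 2) 1 (msx x) fx.
split; first by rewrite /tau E.
by rewrite /tau E /= -/(v x) /sigma /kmean; field.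
Qed.

Let iv : Q0.-integrable setT (EFin \o v).
Proof.
apply/integrableP; split; first exact/measurable_EFinP.
apply: le_lt_trans s2; rewrite (ge0_integral_joint P0E); [|by meas|by nonneg].
apply: ge0_le_integral => //.
- by apply: measurableT_comp => //; exact/measurable_EFinP.
- by apply: (measurable_ksection K (f := fun z => (s z ^+ 2)%:E)); [meas|nonneg].
- move=> x _; rewrite gee0_abs ?lee_fin// -[X in X <= _]/((v x)%:E) /v.
  have : 0 <= \int[K x]_y (s (x, y) ^+ 2)%:E by apply: integral_ge0; nonneg.
  by case: (\int[K x]_y (s (x, y) ^+ 2)%:E) => //= _; exact: leey.
Qed.

Let L20_sigma : L20 Q0 sigma.
Proof.
have [[sL s0] _] := score_s.
have [_ sL2] := Lfun2_kmean P0E sL; split=> //.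
rewrite expectation.unlock; have [i _] := sqr_integrable (@probability_setT _ _ _ (P t0)) ms s2.
have [_ <-] := integral_kmean P0E i.
by move: s0; rewrite expectation.unlock.
Qed.

(** [hellinger_contraction] for the densities of [P t] and of (1 + h s / 2)^2 P t0. *)
Let contraction (m : probability (X * Y)%type R) (p p0 : X * Y -> R)
    (q q0 : X -> R) (t h : R) :
  is_density m (P t) p -> is_density m (P t0) p0 ->
  is_density (marginal m) (marginal (P t)) q ->
  is_density (marginal m) Q0 q0 ->
  \int[marginal m]_x ((Num.sqrt (q x) - Num.sqrt (q0 x * tau h x)) ^+ 2)%:E <=
  qmd_error m p p0 s h.
Proof.
move=> [mp p_ge0 pE] [mp0 p0_ge0 p0E] [mq q_ge0 qE] [mq0 q0_ge0 q0E].
pose G z := (p0 z * (1 + h / 2 * s z) ^+ 2)%R.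
have mG : measurable_fun setT G by rewrite /G; meas.
have G0 z : (0 <= G z)%R by rewrite /G mulr_ge0// sqr_ge0.
have hF (phi : X -> R) : measurable_fun setT phi -> (forall x, (0 <= phi x)%R) ->
    \int[m]_z (phi z.1 * p z)%:E = \int[marginal m]_x (phi x * q x)%:E.
  move=> mphi phi0.
  rewrite -(ge0_integral_density mq q_ge0 qE (f := EFin \o phi)); [|by meas|by nonneg].
  rewrite ge0_integral_marginal; [|by meas|by nonneg].
  by rewrite (ge0_integral_density mp p_ge0 pE (f := fun z => (phi z.1)%:E)); [|by meas|by nonneg].
have hG (phi : X -> R) : measurable_fun setT phi -> (forall x, (0 <= phi x)%R) ->
    \int[m]_z (phi z.1 * G z)%:E = \int[marginal m]_x (phi x * (q0 x * tau h x))%:E.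
  move=> mphi phi0.
  transitivity (\int[P t0]_z (phi z.1 * (1 + h / 2 * s z) ^+ 2)%:E).
    rewrite (ge0_integral_density mp0 p0_ge0 p0E (f := fun z => (phi z.1 * (1 + h / 2 * s z) ^+ 2)%:E)); [|by meas|by nonneg].
    apply: eq_integral => z _; rewrite -EFinM; congr EFin; rewrite /G; ring.
  rewrite (ge0_integral_joint P0E); [|by meas|by nonneg].
  transitivity (\int[Q0]_x (phi x * tau h x)%:E).
    apply: ae_eq_integral => //.
    - by apply: (measurable_ksection K (f := fun z => (phi z.1 * (1 + h / 2 * s z) ^+ 2)%:E)); [meas|nonneg].
    - by apply/measurable_EFinP/measurable_funM.
    apply: filterS (tauE h) => x [E _] _ /=.
    under eq_integral do rewrite EFinM.
    have msx' := msx x.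
    rewrite ge0_integralZl//; try (by nonneg); try (by meas).
    by rewrite E.
  rewrite (ge0_integral_density mq0 q0_ge0 q0E (f := fun x => (phi x * tau h x)%:E)); last 2 first.
  - by apply/measurable_EFinP/measurable_funM.
  - by nonneg.
  by apply: eq_integral => z _; rewrite -EFinM; congr EFin; ring.
have iF : \int[m]_z (p z)%:E < +oo by rewrite -pE// (le_lt_trans (probability_le1 _ _)) ?ltry.
have iG : \int[m]_z (G z)%:E < +oo.
  have := integral_sqr_affine (@probability_setT _ _ _ (P t0)) (h / 2) 1 ms s2.
  rewrite (ge0_integral_density mp0 p0_ge0 p0E (f := fun z => ((1 + h / 2 * s z) ^+ 2)%:E)); [|by meas|by nonneg].
  under [in X in X = _ -> _]eq_integral do rewrite -EFinM mulrC -/(G _).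
  by move=> ->; exact: ltry.
apply: le_trans (hellinger_contraction mp mG mq _ p_ge0 G0 q_ge0 _ iF iG hF hG) _.
- exact: measurable_funM.
- by move=> x; rewrite mulr_ge0.
apply: ge0_le_integral => //; try (by nonneg); try (by meas).
(* The root of [G] contains |1 + h s / 2|. Removing the absolute value can only increase the square,
   since both roots of densities are nonnegative. *)
move=> z _; rewrite lee_fin /G sqrtrM// sqrtr_sqr.
set a := Num.sqrt (p z); set b := Num.sqrt (p0 z).
have a0 : (0 <= a)%R by exact: sqrtr_ge0.
have b0 : (0 <= b)%R by exact: sqrtr_ge0.
rewrite (_ : (a - b - h / 2 * s z * b = a - b * (1 + h / 2 * s z))%R); last by ring.
set c := (1 + h / 2 * s z)%R.
have : (c <= `|c|)%R by exact: ler_norm.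
have : (`|c| ^+ 2 = c ^+ 2)%R by rewrite real_normK// num_real.
have := mulr_ge0 a0 b0; nra.
Qed.

(** With q and q0 the marginal densities at t and t0, the error sqrt q - sqrt q0 - (h / 2) sigma
    sqrt q0 is the sum of sqrt q - sqrt (q0 tau) and (sqrt tau - 1 - (h / 2) sigma) sqrt q0. The
    former is controlled by [contraction], the latter by [cvg_sqrt_remainder]; the factor 2 below
    comes from squaring a sum. *)
Lemma marginal_score : is_score I t0 (fun t => marginal (P t)) sigma.
Proof.
split=> //; have [m [p [pd cvgp]]] := is_score_probability oI It0 score_s.
have /choice[q qP] : forall t, exists q, I t ->
    is_density (marginal m) (marginal (P t)) q.
  move=> t; have [It|nIt] := pselect (I t); last by exists (fun=> 0%R).
  by have [q qd] := marginal_density (pd _ It); exists q.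
exists (marginal m), q; split=> //.
have [mq0 q00 q0E] := qP _ It0.
pose rem t := (\int[Q0]_x ((Num.sqrt (1 + (t - t0) * sigma x +
  ((t - t0) / 2) ^+ 2 * v x) - 1 - (t - t0) / 2 * sigma x) ^+ 2)%:E)
  * ((t - t0) ^- 2)%:E.
have cvgr : rem t @[t --> t0^'] --> 0 := cvg_sqrt_remainder msigma mv v0 iv sigma_v t0.
have cvgs : (qmd_error m (p t) (p t0) s (t - t0) * ((t - t0) ^- 2)%:E + rem t)
    @[t --> t0^'] --> 0 + 0 by apply: cvgeD.
have := cvgeZl (y := 2%:E) isT cvgs; rewrite adde0 mule0 => {}cvgs.
apply: (squeeze_cvge _ (cvg_cst 0) cvgs).
have : \forall t \near t0^', I t.
  by apply: nbhs_dnbhs; exact: open_nbhs_nbhs.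
apply: filterS => t It; set h := (t - t0)%R.
have h2 : 0 <= (h ^- 2)%:E by rewrite lee_fin invr_ge0 sqr_ge0.
have [mq qt0 qE] := qP _ It.
apply/andP; split; first by rewrite mule_ge0// integral_ge0//; nonneg.
rewrite -ge0_muleDl; last 2 first.
- by rewrite integral_ge0//; nonneg.
- by rewrite integral_ge0//; nonneg.
rewrite muleA; apply: lee_wpmul2r => //.
pose r x := (Num.sqrt (1 + h * sigma x + (h / 2) ^+ 2 * v x) - 1 - h / 2 * sigma x)%R.
have mr : measurable_fun setT r by rewrite /r; meas.
have mth : measurable_fun setT (tau h) by exact: mtau.
have mqt : measurable_fun setT (fun x => q t0 x * tau h x)%R by exact: measurable_funM.
rewrite -/r; apply: (@le_trans _ _ (2%:E * (\int[marginal m]_x ((Num.sqrt (q t x) - Num.sqrt (q t0 x * tau h x)) ^+ 2)%:E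
   + \int[Q0]_x (r x ^+ 2)%:E))); last first.
  by apply: lee_wpmul2l => //; apply: leeD2r; exact: contraction (pd _ It) (pd _ It0) (qP _ It) (qP _ It0).
rewrite (_ : \int[Q0]_x (r x ^+ 2)%:E =
   \int[Q0]_x ((Num.sqrt (tau h x) - 1 - h / 2 * sigma x) ^+ 2)%:E); last first.
  apply: ae_eq_integral => //; try (by meas).
  by apply: filterS (tauE h) => x [_ E] _; rewrite /r E.
rewrite (ge0_integral_density mq0 q00 q0E); [|by meas|by nonneg].
rewrite -ge0_integralD//; try (by nonneg); last 2 first.
- by meas.
- by apply: emeasurable_funM; meas.
rewrite -ge0_integralZl//; last 2 first.
- by apply: emeasurable_funD; [meas|apply: emeasurable_funM; meas].
- by move=> x _; apply: adde_ge0; [|apply: mule_ge0]; nonneg.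
apply: ge0_le_integral => //.
- by nonneg.
- by meas.
- by apply: emeasurable_funM => //; apply: emeasurable_funD; [meas|apply: emeasurable_funM; meas].
move=> x _; rewrite -[leRHS]/((2 * ((Num.sqrt (q t x) - Num.sqrt (q t0 x * tau h x)) ^+ 2
  + (Num.sqrt (tau h x) - 1 - h / 2 * sigma x) ^+ 2 * q t0 x))%R%:E) lee_fin sqrtrM//.
set a := Num.sqrt (q t x); set b := Num.sqrt (q t0 x); set w := Num.sqrt (tau h x).
have <- : (b ^+ 2 = q t0 x)%R by rewrite sqr_sqrtr.
set c := (h / 2 * sigma x)%R.
have := sqr_ge0 ((a - b * w) - (w - 1 - c) * b)%R; nra.
Qed.

End marginal_submodels.

(** * Derivatives of the probabilities of events *)

Section score_derivative.
Local Open Scope ereal_scope.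
Context d (T : measurableType d) (R : realType).

Lemma integral_density (mu : {measure set T -> \bar R}) (k : probability T R)
    (p f : T -> R) : is_density mu k p -> k.-integrable setT (EFin \o f) ->
  mu.-integrable setT (fun x => (f x * p x)%:E) /\
  \int[k]_x (f x)%:E = \int[mu]_x (f x * p x)%:E.
Proof.
move=> [mp p0 pE] /integrableP[/measurable_EFinP mf fi].
pose fp x := ((`|f x| + f x) / 2)%R; pose fm x := ((`|f x| - f x) / 2)%R.
have mabs : measurable_fun setT (fun x => `|f x|%R) by exact: measurableT_comp.
have mfp : measurable_fun setT fp by rewrite /fp; meas.
have mfm : measurable_fun setT fm by rewrite /fm; meas.
have fp0 x : (0 <= fp x)%R.
  by rewrite /fp divr_ge0//; have := ler_norm (- f x)%R; rewrite normrN; lra.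
have fm0 x : (0 <= fm x)%R.
  by rewrite /fm divr_ge0//; have := ler_norm (f x); lra.
have fE x : (f x = fp x - fm x)%R by rewrite /fp /fm; field.
have part (g : T -> R) : measurable_fun setT g -> (forall x, (0 <= g x)%R) ->
    (forall x, (g x <= `|f x|)%R) ->
    [/\ k.-integrable setT (EFin \o g),
        mu.-integrable setT (fun x => (g x * p x)%:E) &
        \int[k]_x (g x)%:E = \int[mu]_x (g x * p x)%:E].
  move=> mg g0 gf.
  have E : \int[k]_x (g x)%:E = \int[mu]_x (g x * p x)%:E.
    by rewrite (ge0_integral_density mp p0 pE (f := EFin \o g)); [|meas|nonneg].
  have lty : \int[k]_x (g x)%:E < +oo.
    apply: le_lt_trans fi; apply: ge0_le_integral => //; try (by nonneg); try (by meas).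
    by apply: measurableT_comp => //; exact/measurable_EFinP.
  split=> //; apply/integrableP; split; [by meas| |by meas|].
  - by under eq_integral do rewrite gee0_abs ?lee_fin//.
  - rewrite E in lty; apply: le_lt_trans lty.
    by under eq_integral do rewrite gee0_abs ?lee_fin ?mulr_ge0//.
have fpf x : (fp x <= `|f x|)%R.
  by rewrite /fp ler_pdivrMr//; have := ler_norm (f x); lra.
have fmf x : (fm x <= `|f x|)%R.
  by rewrite /fm ler_pdivrMr//; have := ler_norm (- f x)%R; rewrite normrN; lra.
have [i1 i2 E1] := part _ mfp fp0 fpf; have [j1 j2 E2] := part _ mfm fm0 fmf.
have E x : (f x * p x)%:E = (fp x * p x)%:E - (fm x * p x)%:E.
  by rewrite -EFinB -mulrBl -fE.
split; first by under eq_fun do rewrite E; exact: integrableB.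
transitivity (\int[k]_x ((fp x)%:E - (fm x)%:E)).
  by apply: eq_integral => x _; rewrite -EFinB -fE.
by under [RHS]eq_integral do rewrite E; rewrite !integralB// E1 E2.
Qed.

(** Here f and f0 are roots of densities. With g = (1 + h s / 2) f0 and r the remainder, f = g + r,
    and the left-hand expression is h^2 s^2 f0^2 / 4 + 2 g r + r^2. The cross term is split by the
    inequality of arithmetic and geometric means, with a weight l left free. *)
Lemma qmd_pointwise (f f0 s h l : R) : (0 < l)%R ->
  (`|f ^+ 2 - f0 ^+ 2 - h * (s * f0 ^+ 2)| <=
   h ^+ 2 / 4 * (s ^+ 2 * f0 ^+ 2) + l * ((1 + h / 2 * s) ^+ 2 * f0 ^+ 2)
   + (l^-1 + 1) * (f - f0 - h / 2 * s * f0) ^+ 2)%R.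
Proof.
move=> l0; set r := (f - f0 - h / 2 * s * f0)%R; set g := ((1 + h / 2 * s) * f0)%R.
have -> : (f ^+ 2 - f0 ^+ 2 - h * (s * f0 ^+ 2) =
    h ^+ 2 / 4 * (s ^+ 2 * f0 ^+ 2) + 2 * g * r + r ^+ 2)%R.
  by rewrite /g /r; field.
have -> : ((1 + h / 2 * s) ^+ 2 * f0 ^+ 2 = g ^+ 2)%R by rewrite /g exprMn.
have h1 : (0 <= h ^+ 2 / 4 * (s ^+ 2 * f0 ^+ 2))%R.
  by nonneg.
have amgm (e : R) : (e ^+ 2 = 1)%R -> (2 * (e * (g * r)) <= l * g ^+ 2 + l^-1 * r ^+ 2)%R.
  move=> e2; rewrite -subr_ge0.
  have -> : (l * g ^+ 2 + l^-1 * r ^+ 2 - 2 * (e * (g * r)) = (l * g - e * r) ^+ 2 / l)%R.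
    transitivity ((l * g ^+ 2 + e ^+ 2 * l^-1 * r ^+ 2 - 2 * (e * (g * r)))%R).
      by rewrite e2 mul1r.
    by field; rewrite gt_eqF.
  by rewrite divr_ge0 ?sqr_ge0// ltW.
have := amgm 1%R (expr1n _ _); have := amgm (-1)%R (ltac:(by rewrite sqrrN expr1n)).
have := sqr_ge0 r; rewrite mulrDl !mul1r mulN1r => r2 u1 u2.
by rewrite ler_norml; apply/andP; split; lra.
Qed.

(** Integrating [qmd_pointwise] over [A] shows that t |-> P t A is differentiable at t0, with
    derivative the integral of [s] over [A]. This ties any score to the measures themselves. *)
Lemma score_derivative (I : set R) (t0 : R) (P : R -> probability T R)
    (s : T -> R) (A : set T) : open I -> I t0 -> is_score I t0 P s ->
  measurable A -> forall e : R, (0 < e)%R -> \forall t \near t0^',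
  (`|fine (P t A) - fine (P t0 A)
    - (t - t0) * fine (\int[P t0]_x (\1_A x * s x)%:E)| <= e * `|t - t0|)%R.
Proof.
move=> oI It0 ss mA e e0; have [[sL s0] _] := ss.
have [ms s2] := iffLR (Lfun2P _ _) sL.
have P1 := @probability_setT _ _ _ (P t0).
have [si s2i] := sqr_integrable P1 ms s2.
have Es0 : \int[P t0]_x (s x)%:E = 0 by move: s0; rewrite expectation.unlock.
pose V := fine (\int[P t0]_x (s x ^+ 2)%:E).
have VE : \int[P t0]_x (s x ^+ 2)%:E = V%:E.
  by rewrite fineK//; exact: (integrable_fin_num measurableT s2i).
have V0 : (0 <= V)%R by rewrite fine_ge0// integral_ge0//; nonneg.
have [m [p [pd cvgp]]] := is_score_probability oI It0 ss.
have pd0 := pd _ It0; have [mp0 p00 p0E] := pd0.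
have m1A : measurable_fun setT (\1_A : T -> R) by exact: measurable_indic.
have isA : (P t0).-integrable setT (EFin \o (fun x => \1_A x * s x)%R).
  apply: (le_integrable measurableT _ _ si); first by meas.
  move=> x _; rewrite /= lee_fin normrM indicE.
  by case: (_ \in _); rewrite ?normr1 ?normr0 ?mul1r ?mul0r.
have [ims Ems] := integral_density pd0 isA.
pose c := fine (\int[P t0]_x (\1_A x * s x)%:E).
have cE : \int[m]_x (\1_A x * s x * p t0 x)%:E = c%:E.
  by rewrite -Ems /c fineK//; exact: (integrable_fin_num measurableT isA).
have indA t : I t -> m.-integrable setT (fun x => (\1_A x * p t x)%:E) /\
    \int[m]_x (\1_A x * p t x)%:E = (fine (P t A))%:E.
  move=> It.
  have iA : (P t).-integrable setT (EFin \o \1_A).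
    exact: integrable_indic.
  have [i E] := integral_density (pd _ It) iA; split=> //.
  rewrite -E integral_indic// setIT fineK//; exact: fin_num_measure.
have main t l : I t -> (0 < l)%R ->
    (`|fine (P t A) - fine (P t0 A) - (t - t0) * c|)%:E <=
    ((t - t0) ^+ 2 / 4 * V + l * (1 + ((t - t0) / 2) ^+ 2 * V))%:E +
    (l^-1 + 1)%:E * qmd_error m (p t) (p t0) s (t - t0).
  move=> It l0; set h := (t - t0)%R.
  have [mp pt0 pE] := pd _ It.
  have [i1 E1] := indA _ It; have [i2 E2] := indA _ It0.
  have i3 := @integrableZl _ _ _ m setT measurableT h _ ims.
  pose a x := (\1_A x * p t x - \1_A x * p t0 x - h * (\1_A x * s x * p t0 x))%R.
  have aE : \int[m]_x (a x)%:E = (fine (P t A) - fine (P t0 A) - h * c)%:E.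
    rewrite (_ : \int[m]_x _ = \int[m]_x ((\1_A x * p t x)%:E
      - (\1_A x * p t0 x)%:E - h%:E * (\1_A x * s x * p t0 x)%:E))//.
    rewrite integralB//; last exact: integrableB.
    by rewrite integralB// integralZl// E1 E2 cE.
  have ma : measurable_fun setT a by rewrite /a; meas.
  rewrite -abse_EFin -aE; apply: (le_trans (le_abse_integral m measurableT _)); first by meas.
  pose b1 x := (h ^+ 2 / 4 * (s x ^+ 2 * p t0 x))%R.
  pose b2 x := (l * ((1 + h / 2 * s x) ^+ 2 * p t0 x))%R.
  pose b3 x := ((l^-1 + 1) * (Num.sqrt (p t x) - Num.sqrt (p t0 x)
               - h / 2 * s x * Num.sqrt (p t0 x)) ^+ 2)%R.
  have mb1 : measurable_fun setT b1 by rewrite /b1; meas.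
  have mb2 : measurable_fun setT b2 by rewrite /b2; meas.
  have mb3 : measurable_fun setT b3 by rewrite /b3; meas.
  have b10 x : (0 <= b1 x)%R by rewrite /b1; nonneg.
  have l0' : (0 <= l)%R by exact: ltW.
  have b20 x : (0 <= b2 x)%R by rewrite /b2; nonneg.
  have li : (0 <= l^-1 + 1)%R by rewrite addr_ge0 ?invr_ge0.
  have b30 x : (0 <= b3 x)%R by rewrite /b3 mulr_ge0 ?sqr_ge0.
  apply: (@le_trans _ _ (\int[m]_x ((b1 x)%:E + (b2 x)%:E + (b3 x)%:E))).
    apply: ge0_le_integral => //.
    - by apply: measurableT_comp => //; meas.
    - by rewrite (_ : (fun x => _) = EFin \o (fun x => b1 x + b2 x + b3 x)%R)//; meas.
    move=> x _; rewrite abse_EFin -!EFinD lee_fin.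
    have -> : (a x = \1_A x * (p t x - p t0 x - h * (s x * p t0 x)))%R.
      by rewrite /a; ring.
    have := qmd_pointwise (Num.sqrt (p t x)) (Num.sqrt (p t0 x)) (s x) h l0.
    rewrite !sqr_sqrtr// -/(b1 x) -/(b2 x) -/(b3 x); apply: le_trans.
    rewrite normrM indicE; case: (_ \in _); rewrite ?normr1 ?normr0 ?mul1r ?mul0r//.
  have qE (g : T -> R) : measurable_fun setT g ->
      \int[m]_x (g x ^+ 2 * p t0 x)%:E = \int[P t0]_x (g x ^+ 2)%:E.
    move=> mg; rewrite (ge0_integral_density mp0 p00 p0E (f := fun x => (g x ^+ 2)%:E)) //; by [meas|nonneg].
  rewrite !ge0_integralD//; try (by nonneg); try (by meas); last first.
    by rewrite (_ : (fun x => _) = EFin \o (fun x => b1 x + b2 x)%R)//; meas.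
  have Zl (k : R) (g : T -> R) : (0 <= k)%R -> measurable_fun setT g ->
      (forall x, (0 <= g x)%R) -> \int[m]_x (k * g x)%:E = k%:E * \int[m]_x (g x)%:E.
    by move=> k0 mg g0; rewrite -ge0_integralZl//; try (by nonneg); try (by meas).
  apply: leeD; last first.
    by rewrite /b3 Zl//; [by meas|by nonneg].
  rewrite EFinD; apply: leeD.
    rewrite /b1 Zl; [|by nonneg|by meas|by nonneg].
    by rewrite qE// VE.
  rewrite /b2 Zl//; [|by meas|by nonneg].
  rewrite qE; last by meas.
  rewrite (integral_sqr_affine P1 (h / 2) 1 ms s2) -/V Es0 /= -EFinM lee_fin.
  by rewrite expr1n mulr0 addr0.
(* The weight will be l = e |h| / 4 with h = t - t0. Then [del] bounds the term in l^-1 by e |h| /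
   4, and [eta] makes |h| V at most e / 2 and |h|, |h| V, |h| e at most 1, which leaves room for the
   other terms. *)
pose del := (e ^+ 2 / 16)%R.
have del0 : (0 < del)%R by rewrite divr_gt0 ?exprn_gt0.
pose eta := (Num.min 1 (e / 2) / (1 + V + e))%R.
have den0 : (0 < 1 + V + e)%R by move: V0 e0; lra.
have eta0 : (0 < eta)%R by rewrite divr_gt0// lt_min ltr01 divr_gt0.
near=> t.
have It : I t by near: t; apply: nbhs_dnbhs; exact: open_nbhs_nbhs.
have tt0 : t != t0 by near: t; exact: nbhs_dnbhs_neq.
have kh : (`|t - t0| < eta)%R.
  near: t; apply: nbhs_dnbhs; apply/nbhs_ballP; exists eta => //= u.
  by rewrite /ball/= distrC.
have qh : qmd_error m (p t) (p t0) s (t - t0) * ((t - t0) ^- 2)%:E < del%:E.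
  have qf : qmd_error m (p t) (p t0) s (t - t0) * ((t - t0) ^- 2)%:E \is a fin_num.
    by near: t; have [] := iffLR (fine_cvgP _ _) cvgp.
  rewrite -(fineK qf) lte_fin; near: t.
  have [_ nc] := iffLR (fine_cvgP _ _) cvgp.
  exact: (cvgr_lt _ nc).
set h := (t - t0)%R in kh qh *.
have h0 : h != 0%R by rewrite subr_eq0.
have k0 : (0 < `|h|)%R by rewrite normr_gt0.
have qle : qmd_error m (p t) (p t0) s h <= (del * h ^+ 2)%:E.
  rewrite EFinM -lee_pdivrMr; last by rewrite exprn_even_gt0.
  exact: ltW.
have l0 : (0 < e / 4 * `|h|)%R by rewrite mulr_gt0// divr_gt0.
have := main _ _ It l0; rewrite -/h => mle.
rewrite -lee_fin; apply: (le_trans mle).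
apply: (@le_trans _ _ ((h ^+ 2 / 4 * V + (e / 4 * `|h|) * (1 + (h / 2) ^+ 2 * V))%:E +
    ((e / 4 * `|h|)^-1 + 1)%:E * (del * h ^+ 2)%:E)).
  apply: leeD2l; apply: lee_wpmul2l => //.
  by rewrite lee_fin addr_ge0 ?invr_ge0 ?ltW.
rewrite -EFinM -EFinD lee_fin.
have hk : (h ^+ 2 = `|h| ^+ 2)%R by rewrite real_normK// num_real.
rewrite exprMn exprVn hk /del; set k := `|h|%R in k0 kh *.
have kb : (k * (1 + V + e) <= Num.min 1 (e / 2))%R.
  by rewrite -ler_pdivlMr// ltW.
have kb1 : (k * (1 + V + e) <= 1)%R by apply: (le_trans kb); rewrite ge_min lexx.
have kb2 : (k * (1 + V + e) <= e / 2)%R by apply: (le_trans kb); rewrite ge_min lexx orbT.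
have kV : (0 <= k * V)%R by rewrite mulr_ge0// ltW.
have ke : (0 <= k * e)%R by rewrite mulr_ge0// ltW.
have -> : (((e / 4 * k)^-1 + 1) * (e ^+ 2 / 16 * k ^+ 2) =
   k * (e / 4 + (k * e) * e / 16))%R.
  by field; rewrite !gt_eqF.
have -> : (k ^+ 2 / 4 * V + e / 4 * k * (1 + k ^+ 2 / 2 ^+ 2 * V) =
   k * ((k * V) / 4 + e / 4 * (1 + k * (k * V) / 4)))%R.
  by field.
rewrite -mulrDr mulrC ler_wpM2r//; first exact: ltW.
have kE : (k * (1 + V + e) = k + k * V + k * e)%R by ring.
rewrite kE in kb1 kb2.
have k00 : (0 <= k)%R by exact: ltW.
have e00 : (0 <= e)%R by exact: ltW.
have a1 : (k <= 1)%R by move: kb1 kV ke; clear; lra.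
have a2 : (k * V <= e / 2)%R by move: kb2 k00 ke; clear; lra.
have a3 : (k * V <= 1)%R by move: kb1 k00 ke; clear; lra.
have a4 : (k * e <= 1)%R by move: kb1 k00 kV; clear; lra.
have b1 : (k * (k * V) <= 1)%R by exact: mulr_ile1.
have b2 : (e * (k * (k * V)) <= e)%R by exact: ler_piMr.
have b3 : ((k * e) * e <= e)%R by exact: ler_piMl.
move: a2 b2 b3 e00; clear; lra.
Unshelve. all: by end_near. Qed.

End score_derivative.

(** * Inner products and conditional expectation as a projection *)

Section inner_product.
Context d (T : measurableType d) (R : realType) (P : probability T R).
Implicit Types f g h : T -> R.

Definition ip f g : R := fine 'E_P[fun x => (f x * g x)%R]%E.

Lemma Lfun2_mul_integrable f g : f \in Lfun P 2%:E -> g \in Lfun P 2%:E ->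
  P.-integrable setT (EFin \o (fun x => f x * g x)).
Proof. by move=> fL gL; apply/Lfun1_integrable; exact: Lfun2_mul_Lfun1. Qed.

Lemma ipE f g : f \in Lfun P 2%:E -> g \in Lfun P 2%:E ->
  (\int[P]_x (f x * g x)%:E = (ip f g)%:E)%E.
Proof.
move=> fL gL; rewrite /ip expectation.unlock fineK//.
exact: (integrable_fin_num measurableT (Lfun2_mul_integrable fL gL)).
Qed.

Lemma ipC f g : ip f g = ip g f.
Proof. by rewrite /ip; congr (fine _); congr (expectation P _); apply/funext => x; rewrite mulrC. Qed.

Lemma Lfun2D f g : f \in Lfun P 2%:E -> g \in Lfun P 2%:E ->
  (fun x => f x + g x) \in Lfun P 2%:E.
Proof.
have p1 : (1 <= 2%:E :> \bar R)%E by rewrite lee_fin ler1n.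
by move=> fL gL; have [_] := Lfun_addr_closed P p1; apply.
Qed.

Lemma Lfun2Z a f : f \in Lfun P 2%:E -> (fun x => a * f x) \in Lfun P 2%:E.
Proof.
move=> /Lfun2P[mf f2]; apply/Lfun2P; split; first by meas.
under eq_integral do rewrite exprMn EFinM.
rewrite ge0_integralZl//; [|by meas|by nonneg|by rewrite lee_fin sqr_ge0].
by rewrite lte_mul_pinfty// lee_fin sqr_ge0.
Qed.

Lemma Lfun2B f g : f \in Lfun P 2%:E -> g \in Lfun P 2%:E ->
  (fun x => f x - g x) \in Lfun P 2%:E.
Proof.
move=> fL gL; have -> : (fun x => f x - g x) = (fun x => f x + -1 * g x).
  by apply/funext => x; rewrite mulN1r.
exact/Lfun2D/Lfun2Z.
Qed.

Lemma Lfun2_0 : (fun=> 0) \in Lfun P 2%:E.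
Proof.
apply/Lfun2P; split; first exact: measurable_cst.
by under eq_integral do rewrite expr0n/=; rewrite integral0 ltry.
Qed.

Lemma Lfun2_sum n (c : 'I_n -> R) (s : 'I_n -> T -> R) :
  (forall k, s k \in Lfun P 2%:E) ->
  (fun x => \sum_k c k * s k x) \in Lfun P 2%:E.
Proof.
move=> sL; elim: n => [|n IH] in c s sL *.
  by under eq_fun do rewrite big_ord0; exact: Lfun2_0.
under eq_fun do rewrite big_ord_recr.
by apply: Lfun2D; [exact: IH|exact: Lfun2Z].
Qed.

Lemma ipDl f g h : f \in Lfun P 2%:E -> g \in Lfun P 2%:E -> h \in Lfun P 2%:E ->
  ip (fun x => f x + g x) h = ip f h + ip g h.
Proof.
move=> fL gL hL; apply: EFin_inj; rewrite EFinD -!ipE//; last exact: Lfun2D.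
rewrite -integralD//; try exact: Lfun2_mul_integrable.
by apply: eq_integral => x _; rewrite mulrDl.
Qed.

Lemma ipZl a f h : f \in Lfun P 2%:E -> h \in Lfun P 2%:E ->
  ip (fun x => a * f x) h = a * ip f h.
Proof.
move=> fL hL; apply: EFin_inj; rewrite EFinM -!ipE//; last exact: Lfun2Z.
rewrite -integralZl//; try exact: Lfun2_mul_integrable.
by apply: eq_integral => x _; rewrite -EFinM mulrA.
Qed.

Lemma ipBl f g h : f \in Lfun P 2%:E -> g \in Lfun P 2%:E -> h \in Lfun P 2%:E ->
  ip (fun x => f x - g x) h = ip f h - ip g h.
Proof.
move=> fL gL hL; have -> : (fun x => f x - g x) = (fun x => f x + -1 * g x).
  by apply/funext => x; rewrite mulN1r.
by rewrite ipDl ?Lfun2Z// ipZl// mulN1r.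
Qed.

Lemma ipBr f g h : f \in Lfun P 2%:E -> g \in Lfun P 2%:E -> h \in Lfun P 2%:E ->
  ip h (fun x => f x - g x) = ip h f - ip h g.
Proof. by move=> fL gL hL; rewrite ipC ipBl// ipC [in X in _ - X]ipC. Qed.

Lemma ipZr a f h : f \in Lfun P 2%:E -> h \in Lfun P 2%:E ->
  ip h (fun x => a * f x) = a * ip h f.
Proof. by move=> fL hL; rewrite ipC ipZl// ipC. Qed.

Lemma ip_suml n (c : 'I_n -> R) (s : 'I_n -> T -> R) h :
  (forall k, s k \in Lfun P 2%:E) -> h \in Lfun P 2%:E ->
  ip (fun x => \sum_k c k * s k x) h = \sum_k c k * ip (s k) h.
Proof.
move=> sL hL; elim: n => [|n IH] in c s sL *.
  rewrite big_ord0 (_ : (fun _ => _) = fun=> 0 * 0).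
    by rewrite ipZl ?Lfun2_0// mul0r.
  by apply/funext => x; rewrite big_ord0 mul0r.
under eq_fun do rewrite big_ord_recr.
by rewrite ipDl ?Lfun2Z// ?Lfun2_sum// IH// ipZl// big_ord_recr.
Qed.

Lemma ip_ge0 f : 0 <= ip f f.
Proof.
rewrite /ip expectation.unlock fine_ge0// integral_ge0// => x _.
by rewrite lee_fin -expr2 sqr_ge0.
Qed.

Lemma ip_eq0_ae f : f \in Lfun P 2%:E -> ip f f = 0 -> {ae P, forall x, f x = 0}.
Proof.
move=> fL f0; have := ipE fL fL; rewrite f0 => i0.
have mf := Lfun2_measurable fL.
have : (\int[P]_x `|(f x * f x)%:E| = 0)%E.
  transitivity (\int[P]_x (f x * f x)%:E)%E; last exact: i0.
  by apply: eq_integral => x _; rewrite gee0_abs// lee_fin -expr2 sqr_ge0.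
move=> /(ae_eq_integral_abs P measurableT) h.
have {}h := h ltac:(by meas); apply: filterS h => x /(_ I) /= [] /eqP.
by rewrite mulf_eq0 orbb => /eqP.
Qed.

Lemma eq_ip f f' g g' : f \in Lfun P 2%:E -> f' \in Lfun P 2%:E ->
  g \in Lfun P 2%:E -> g' \in Lfun P 2%:E ->
  {ae P, forall x, f x = f' x} -> {ae P, forall x, g x = g' x} ->
  ip f g = ip f' g'.
Proof.
move=> fL fL' gL gL' ff gg; apply: EFin_inj; rewrite -!ipE//.
have mf := Lfun2_measurable fL; have mf' := Lfun2_measurable fL'.
have mg := Lfun2_measurable gL; have mg' := Lfun2_measurable gL'.
apply: ae_eq_integral => //; try (by meas).
by apply: filterS2 ff gg => x -> ->.
Qed.

Lemma ip_L20 f g : L20 P f -> L20 P g -> covariance P f g = (ip f g)%:E.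
Proof.
move=> [fL f0] [gL g0]; have f1 := Lfun_subset12 (fin_num_measure P _ measurableT) fL.
have g1 := Lfun_subset12 (fin_num_measure P _ measurableT) gL.
rewrite covarianceE//; last exact: Lfun2_mul_Lfun1.
rewrite f0 g0 mule0 sube0 -ipE//; by rewrite expectation.unlock.
Qed.

End inner_product.

Section conditional_expectation.
Context dX dY (X : measurableType dX) (Y : measurableType dY) (R : realType).
Variables (P0 : probability (X * Y)%type R) (K : R.-pker X ~> Y).
Let Q0 := marginal P0.
Hypothesis P0E : forall A, measurable A -> P0 A = joint Q0 K A.

Lemma Lfun2_comp_fst (f : X -> R) : f \in Lfun Q0 2%:E ->
  (fun z => f z.1) \in Lfun P0 2%:E.
Proof.
move=> /Lfun2P[mf f2]; apply/Lfun2P; split; first by meas.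
by rewrite -(ge0_integral_marginal P0 (f := fun x => (f x ^+ 2)%:E))//; [meas|nonneg].
Qed.

(** [h] is constant on each fibre; thus [kmean K] is the adjoint of composition with the first
    projection. *)
Lemma ip_kmean (h : X -> R) (f : X * Y -> R) :
  h \in Lfun Q0 2%:E -> f \in Lfun P0 2%:E ->
  ip P0 (fun z => h z.1) f = ip Q0 h (kmean K f).
Proof.
move=> hL fL; have hL' := Lfun2_comp_fst hL.
have [_ kL] := Lfun2_kmean P0E fL.
have mh := Lfun2_measurable hL; have mk := Lfun2_measurable kL.
have mf := Lfun2_measurable fL.
apply: EFin_inj; rewrite -!ipE//.
have [_ ->] := integral_kmean P0E (Lfun2_mul_integrable hL' fL).
apply: ae_eq_integral => //; [|by meas|].
- apply/measurable_EFinP/measurable_kmean; by meas.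
have i : P0.-integrable setT (EFin \o f).
  by apply/Lfun1_integrable; apply: (Lfun_subset12 (fin_num_measure P0 _ measurableT)) fL.
by apply: filterS (ae_kmeanM_fst P0E h i) => x + _; move=> ->.
Qed.

Lemma ae_eq_kmean (f : X * Y -> R) (g : X -> R) : f \in Lfun P0 2%:E ->
  Q0.-integrable setT (EFin \o g) ->
  (forall B, measurable B ->
    \int[Q0]_x (\1_B x * g x)%:E = \int[P0]_z (\1_B z.1 * f z)%:E)%E ->
  {ae Q0, forall x, g x = kmean K f x}.
Proof.
move=> fL ig gE; have [_ kL] := Lfun2_kmean P0E fL.
have i : P0.-integrable setT (EFin \o f).
  by apply/Lfun1_integrable; apply: (Lfun_subset12 (fin_num_measure P0 _ measurableT)) fL.
have mk := Lfun2_measurable kL.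
have key : ae_eq Q0 setT (EFin \o g) (EFin \o kmean K f).
  apply: integral_ae_eq => //; first exact/measurable_EFinP.
  move=> B _ mB; rewrite [LHS]integral_mkcond [RHS]integral_mkcond.
  have indL : (\1_B : X -> R) \in Lfun Q0 2%:E.
    apply/Lfun2P; split; first exact: measurable_indic.
    apply: (@le_lt_trans _ _ (\int[Q0]_x (1 : R)%:E)%E).
      have m1 : measurable_fun setT (\1_B : X -> R) by exact: measurable_indic.
      apply: ge0_le_integral => //; try (by nonneg); try (by meas).
    by rewrite integral_cst//= probability_setT mule1 ltry.
  transitivity (\int[Q0]_x (\1_B x * g x)%:E)%E.
    apply: eq_integral => x _; rewrite patchE indicE.
    by case: (_ \in _); rewrite ?mul1r ?mul0r.
  rewrite gE// (ipE (Lfun2_comp_fst indL) fL).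
  rewrite ip_kmean// -ipE//; apply: eq_integral => x _; rewrite patchE indicE.
  by case: (_ \in _); rewrite ?mul1r ?mul0r.
by apply: filterS key => x /(_ I) [].
Qed.

(** The derivative of the probability of {X in B} is the integral of [sX] over B by the marginal
    score, and that of [s] over the preimage of B by the joint score. So [sX] has the defining
    property of E[s | X]. *)
Lemma marginal_score_unique (I : set R) (t0 : R) (P : R -> probability (X * Y)%type R)
    (s : X * Y -> R) (sX : X -> R) : open I -> I t0 -> P t0 = P0 ->
  is_score I t0 P s -> is_score I t0 (fun t => marginal (P t)) sX ->
  {ae Q0, forall x, sX x = kmean K s x}.
Proof.
move=> oI It0 Pt0 ss ssX.
have [[sL _] _] := ss; have [[sXL _] _] := ssX; rewrite Pt0 in sL sXL.
apply: ae_eq_kmean => //.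
  by apply/Lfun1_integrable; apply: (Lfun_subset12 (fin_num_measure Q0 _ measurableT)) sXL.
move=> B mB.
have mB' : measurable (fst @^-1` B : set (X * Y)).
  by rewrite -[X in measurable X]setTI; exact: measurable_fst.
have fin d (T : measurableType d) (k : probability T R) (f : T -> R) (A : set T) : measurable A ->
    f \in Lfun k 2%:E -> (\int[k]_x (\1_A x * f x)%:E)%E \is a fin_num.
  move=> mA fL; have m1 : measurable_fun setT (\1_A : T -> R) by exact: measurable_indic.
  have mf := Lfun2_measurable fL.
  have i : k.-integrable setT (EFin \o f).
    by apply/Lfun1_integrable; apply: (Lfun_subset12 (fin_num_measure k _ measurableT)) fL.
  apply: (integrable_fin_num measurableT).
  apply: (le_integrable measurableT _ _ i); first by meas.
  move=> x _; rewrite /= lee_fin normrM indicE.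
  by case: (_ \in _); rewrite ?normr1 ?normr0 ?mul1r ?mul0r.
rewrite -(fineK (fin _ _ _ _ _ mB sXL)) -[RHS](fineK (fin _ _ _ _ _ mB' sL)).
congr EFin; apply/eqP; rewrite -subr_eq0 -normr_le0; apply/ler_addgt0Pr => e e0.
rewrite add0r.
have e2 : 0 < e / 2 by rewrite divr_gt0.
have hX := score_derivative oI It0 ssX mB e2.
have hZ := score_derivative oI It0 ss mB' e2.
(* One t that satisfies both expansions is enough: division by |t - t0| bounds the difference of the
   two derivatives by e. *)
suff [t [h1 h2 tt0]] : exists t, [/\ `|fine (marginal (P t) B) - fine (marginal (P t0) B)
    - (t - t0) * fine (\int[marginal (P t0)]_x (\1_B x * sX x)%:E)%E| <= e / 2 * `|t - t0|,
    `|fine (P t (fst @^-1` B)) - fine (P t0 (fst @^-1` B))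
    - (t - t0) * fine (\int[P t0]_x (\1_(fst @^-1` B) x * s x)%:E)%E| <= e / 2 * `|t - t0| &
    t != t0].
  rewrite Pt0 in h1 h2.
  set cX := fine (\int[Q0]_x _)%E; set cZ := fine (\int[P0]_x _)%E.
  have h0 : 0 < `|t - t0| by rewrite normr_gt0 subr_eq0.
  rewrite -(ler_pM2r h0) -normrM.
  set u := fine (marginal (P t) B) in h1; set w := fine (marginal P0 B) in h1.
  rewrite -[fine (P t _)]/u -[fine (P0 _)]/w in h2.
  have -> : (cX - cZ) * (t - t0) = (u - w - (t - t0) * cZ) - (u - w - (t - t0) * cX) by ring.
  apply: (le_trans (ler_normB _ _)).
  apply: (le_trans (lerD h2 h1)); rewrite -mulrDl; by rewrite -splitr.
have neq : \forall t \near t0^', t != t0 by exact: nbhs_dnbhs_neq.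
have : \forall t \near t0^', [/\ `|fine (marginal (P t) B) - fine (marginal (P t0) B)
    - (t - t0) * fine (\int[marginal (P t0)]_x (\1_B x * sX x)%:E)%E| <= e / 2 * `|t - t0|,
    `|fine (P t (fst @^-1` B)) - fine (P t0 (fst @^-1` B))
    - (t - t0) * fine (\int[P t0]_x (\1_(fst @^-1` B) x * s x)%:E)%E| <= e / 2 * `|t - t0| &
    t != t0] by apply: filterS3 hX hZ neq => t ? ? ?; split.
by move=> /(@filter_ex _ _ (Proper_dnbhs_numFieldType t0)).
Qed.

End conditional_expectation.

(** The squared norm of f / 2 - k g is nonnegative; k = 1 and k = -1 give the two signs. *)
Lemma ip_young d (T : measurableType d) (R : realType) (P : probability T R)
    (f g : T -> R) (k : R) : f \in Lfun P 2%:E -> g \in Lfun P 2%:E ->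
  k ^+ 2 = 1 -> k * ip P f g <= ip P f f / 4 + ip P g g.
Proof.
move=> fL gL k2; have f2L := Lfun2Z 2^-1 fL; have kgL := Lfun2Z k gL.
have := ip_ge0 P (fun x => 2^-1 * f x - k * g x).
have dL := Lfun2B f2L kgL.
rewrite ipBl// !ipBr// !ipZl// !ipZr// (ipC P g f).
have -> : k * (k * ip P g g) = ip P g g by rewrite mulrA -expr2 k2 mul1r.
lra.
Qed.

Section conditional_projection.
Context dX dY (X : measurableType dX) (Y : measurableType dY) (R : realType).
Variable P0 : probability (X * Y)%type R.
Let Q0 := marginal P0.

(* g is the orthogonal projection of f onto the functions of x, that is, a
   version of the conditional expectation of f given x. *)
Definition is_projection (f : X * Y -> R) (g : X -> R) : Prop :=
  [/\ f \in Lfun P0 2%:E, g \in Lfun Q0 2%:E &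
   forall h, h \in Lfun Q0 2%:E -> ip P0 f (fun z => h z.1) = ip Q0 g h].

Lemma is_projectionB f g f' g' : is_projection f g -> is_projection f' g' ->
  is_projection (fun z => f z - f' z) (fun x => g x - g' x).
Proof.
move=> [fL gL fg] [fL' gL' fg']; split; [exact: Lfun2B|exact: Lfun2B|].
move=> h hL; have hL' := Lfun2_comp_fst hL.
by rewrite !ipBl// fg// fg'.
Qed.

Lemma is_projection_sum n (c : 'I_n -> R) s sX :
  (forall k, is_projection (s k) (sX k)) ->
  is_projection (fun z => \sum_k c k * s k z) (fun x => \sum_k c k * sX k x).
Proof.
move=> sp; have sL k : s k \in Lfun P0 2%:E by have [] := sp k.
have sXL k : sX k \in Lfun Q0 2%:E by have [] := sp k.
split; [exact: Lfun2_sum|exact: Lfun2_sum|].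
move=> h hL; rewrite !ip_suml//; last exact: Lfun2_comp_fst.
by apply: eq_bigr => k _; have [_ _ ->] := sp k.
Qed.

(** Each of the two cross terms equals - gamma times the inner product of g and g', and the last
    term is gamma^2 times it. *)
Lemma ip_projection (gamma : R) f g f' g' : is_projection f g -> is_projection f' g' ->
  ip P0 (fun z => f z - gamma * g z.1) (fun z => f' z - gamma * g' z.1)
  = ip P0 f f' - gamma * (2 - gamma) * ip Q0 g g'.
Proof.
move=> [fL gL fg] [fL' gL' fg'].
have hL := Lfun2_comp_fst gL; have hL' := Lfun2_comp_fst gL'.
have zL := Lfun2Z gamma hL; have zL' := Lfun2Z gamma hL'.
have dL' := Lfun2B fL' zL'.
rewrite ipBl// !ipBr// !ipZl// !ipZr// fg// (ipC P0 (fun z => g z.1) f') fg'// (ipC Q0 g' g).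
have -> : ip P0 (fun z => g z.1) (fun z => g' z.1) = ip Q0 g g'.
  rewrite /ip !expectation.unlock.
  rewrite -[in RHS]/(pushforward P0 fst) integral_pushforward//.
  - by have mg := Lfun2_measurable gL; have mg' := Lfun2_measurable gL'; meas.
  - exact: Lfun2_mul_integrable hL hL'.
ring.
Qed.

(* Pythagoras: in particular, the squared norm of (f - gamma g, (1 - gamma) g)
   is at most that of f. *)
Lemma oss_inner_projection (gamma : R) f g f' g' : gamma < 1 ->
  is_projection f g -> is_projection f' g' ->
  oss_inner gamma P0 (fun z => f z - gamma * g z.1) (fun x => (1 - gamma) * g x)
    (fun z => f' z - gamma * g' z.1) (fun x => (1 - gamma) * g' x)
  = ip P0 f f' - gamma * ip Q0 g g'.
Proof.
move=> g1 p p'; rewrite /oss_inner -/(ip P0 _ _) -/(ip Q0 _ _) ip_projection//.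
have [_ gL _] := p; have [_ gL' _] := p'.
have zL := Lfun2Z (1 - gamma) gL; have zL' := Lfun2Z (1 - gamma) gL'.
rewrite ipZl// ipZr//; field; lra.
Qed.

Variable K : R.-pker X ~> Y.
Hypothesis P0E : forall A, measurable A -> P0 A = joint Q0 K A.

Lemma is_projection_kmean f : f \in Lfun P0 2%:E -> is_projection f (kmean K f).
Proof.
move=> fL; have [_ kL] := Lfun2_kmean P0E fL; split=> // h hL.
by rewrite ipC (ip_kmean P0E)// ipC.
Qed.

Lemma is_projection_ae f g : f \in Lfun P0 2%:E -> measurable_fun setT g ->
  {ae Q0, forall x, g x = kmean K f x} -> is_projection f g.
Proof.
move=> fL mg gE; have [_ kL kE] := is_projection_kmean fL.
have gL : g \in Lfun Q0 2%:E.
  apply/Lfun2P; split=> //; have /Lfun2P[mk k2] := kL.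
  rewrite (_ : (\int[Q0]_x _)%E = (\int[Q0]_x (kmean K f x ^+ 2)%:E)%E)//.
  apply: ae_eq_integral => //; try (by meas).
  by apply: filterS gE => x -> _.
split=> // h hL; rewrite kE//; apply: eq_ip => //.
- by apply: filterS gE => x ->.
- exact: aeW.
Qed.

Lemma kmean_fst (g : X -> R) : kmean K (fun z => g z.1) = g.
Proof.
apply/funext => x; rewrite /kmean /=.
by rewrite (integral_cst (K x) measurableT) prob_kernel mule1.
Qed.

End conditional_projection.

(** * The OSS tangent space and OSS gradients *)

Section oss_theory.
Context dX dY (X : measurableType dX) (Y : measurableType dY) (R : realType).
Variables (PX : set (probability X R)) (PYX : set (R.-pker X ~> Y)).
Variables (gamma : R) (P0 : probability (X * Y)%type R).
Hypotheses (P0_model : product_model PX PYX P0) (gamma01 : 0 < gamma < 1).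
Let model := product_model PX PYX.
Let Q0 := marginal P0.
Let gamma0 : 0 < gamma. Proof. by have /andP[] := gamma01. Qed.
Let gamma1 : gamma < 1. Proof. by have /andP[] := gamma01. Qed.

Lemma product_model_kernel : exists2 K, PYX K &
  forall A, measurable A -> P0 A = joint Q0 K A.
Proof.
have [Q [K [_ K_in PE]]] := P0_model; exists K => // A mA.
rewrite PE//; apply: eq_measure_integral => B mB _.
by apply/esym; exact: (joint_marginal PE).
Qed.

Lemma oss_score_projection I t0 P s sX : oss_score model P0 I t0 P s sX ->
  is_projection P0 s sX.
Proof.
move=> [[oI It0 _ Pt0 ss] ssX]; have [K _ P0E] := product_model_kernel.
have [[sL _] _] := ss; have [[sXL _] _] := ssX; rewrite Pt0 in sL sXL.
apply: (is_projection_ae P0E) => //; first exact: (Lfun2_measurable sXL).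
exact: (marginal_score_unique P0E oI It0 Pt0 ss ssX).
Qed.

(* The scores of the submodels P_t and P_(t, X) K. *)
Lemma oss_scores I t0 P s : regular_submodel model P0 I t0 P s ->
  exists sX, oss_score model P0 I t0 P s sX /\
    exists P', oss_score model P0 I t0 P' (fun z => sX z.1) sX.
Proof.
move=> reg; have [oI It0 Pm Pt0 ss] := reg.
have [K K_in P0E] := product_model_kernel.
have P0E' A : measurable A -> P t0 A = joint (marginal (P t0)) K A.
  by rewrite Pt0; exact: P0E.
have sX := marginal_score oI It0 P0E' ss.
exists (kmean K s); split; first by split.
(* [marginal (P t)] agrees with a member of [PX] on measurable sets, but need not be that member;
   hence a member is chosen. *)
have /choice[Q QP] : forall t, exists Q, I t ->
    PX Q /\ forall B, measurable B -> marginal (P t) B = Q B.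
  move=> t; have [It|nIt] := pselect (I t); last by exists Q0.
  have [Q [K' [Q_in _ PE]]] := Pm _ It; exists Q => _; split=> //.
  exact: (joint_marginal PE).
(* The value at t0 is imposed, because a submodel must equal [P0] there and not merely agree with it
   on measurable sets. *)
pose P' t := if t == t0 then P0 else joint_prob (Q t) K.
have P't0 : P' t0 = P0 by rewrite /P' eqxx.
have P'E t : I t -> forall A, measurable A -> P' t A = joint (marginal (P t)) K A.
  move=> It A mA; rewrite /P'; have [->|tt0] := eqVneq t t0.
    by rewrite -P0E'// Pt0.
  have [_ QE] := QP _ It; rewrite -[LHS]/(joint (Q t) K A).
  by apply: joint_eq => B mB; apply/esym; exact: QE.
have ss' : is_score I t0 P' (fun z => kmean K s z.1).
  exact: (joint_score oI It0 P'E sX).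
exists P'; split; last first.
  rewrite -[X in is_score _ _ _ X](kmean_fst K); apply: marginal_score => //.
  by move=> A mA; rewrite P't0; exact: P0E.
split=> // t It; rewrite /P'; have [_|tt0] := eqVneq t t0; first exact: P0_model.
by have [Q_in _] := QP _ It; exists (Q t), K.
Qed.

Lemma L20B d (T : measurableType d) (P : probability T R) (f g : T -> R) :
  L20 P f -> L20 P g -> L20 P (fun x => f x - g x).
Proof.
move=> [fL f0] [gL g0]; split; first exact: Lfun2B.
have f1 := Lfun_subset12 (fin_num_measure P _ measurableT) fL.
have g1 := Lfun_subset12 (fin_num_measure P _ measurableT) gL.
by have := expectationB f1 g1; rewrite f0 g0 sube0.
Qed.

Lemma L20Z d (T : measurableType d) (P : probability T R) (a : R) (f : T -> R) :
  L20 P f -> L20 P (fun x => a * f x).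
Proof.
move=> [fL f0]; split; first exact: Lfun2Z.
have f1 := Lfun_subset12 (fin_num_measure P _ measurableT) fL.
have := expectationZl a f1; rewrite f0 mule0 => <-; congr (expectation P _).
by apply/funext => x /=; rewrite mulrC.
Qed.

Lemma oss_tangent_projection (f : X * Y -> R) (g : X -> R) :
  tangent_space model P0 f -> is_projection P0 f g -> L20 Q0 g ->
  oss_tangent_space gamma model P0 (fun z => f z - gamma * g z.1)
    (fun x => (1 - gamma) * g x).
Proof.
move=> [f20 ft] fg g20.
have [fL gL _] := fg; have hL := Lfun2_comp_fst gL.
split.
- by apply: L20B => //; apply: L20Z; exact: L20_comp_fst.
- exact: L20Z.
- move=> e e0; have [n [c [s [reg approx]]]] := ft e e0.
have /choice[sX sXP] k : exists sX, (exists I t0 P, oss_score model P0 I t0 P (s k) sX) /\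
    (exists I t0 P, oss_score model P0 I t0 P (fun z => sX z.1) sX).
  have [I [t0 [P rk]]] := reg k; have [sX [h1 [P' h2]]] := oss_scores rk.
  by exists sX; split; [exists I, t0, P|exists I, t0, P'].
have sp k : is_projection P0 (s k) (sX k).
  have [[I [t0 [P sk]]] _] := sXP k; exact: oss_score_projection sk.
(* The first n indices carry the scores of P_t with coefficients c i, the last n those of P_(t, X) K
   with coefficients - gamma c i. *)
exists (n + n)%N,
  (fun k : 'I_(n + n) => match fintype.split k with
     inl i => c i | inr i => - (gamma * c i) end),
  (fun k : 'I_(n + n) => match fintype.split k with inl i => s i | inr i => fun z => sX i z.1 end),
  (fun k : 'I_(n + n) => match fintype.split k with inl i => sX i | inr i => sX i end).
split; first by move=> k; case: (fintype.split k) => i; have [] := sXP i.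
pose r z := f z - \sum_k c k * s k z; pose q x := g x - \sum_k c k * sX k x.
(* The residual in the OSS space is the image of [r] under the contraction, so its squared norm is
   that of [r] minus gamma times that of [q]. *)
have rq : is_projection P0 r q by apply: is_projectionB => //; exact: is_projection_sum.
have spl i : fintype.split (lshift n i) = inl i := unsplitK (inl i).
have spr i : fintype.split (rshift n i) = inr i := unsplitK (inr i).
rewrite (_ : (fun z => _) = fun z => r z - gamma * q z.1); last first.
  apply/funext => z; rewrite big_split_ord /=.
  rewrite [X in _ - (X + _)](_ : _ = \sum_i c i * s i z); last first.
    by apply: eq_bigr => i _; rewrite spl.
  rewrite [X in _ - (_ + X)](_ : _ = - gamma * \sum_i c i * sX i z.1); last first.
    by rewrite mulr_sumr; apply: eq_bigr => i _; rewrite spr; ring.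
  by rewrite /r /q; ring.
rewrite (_ : (fun x => _) = fun x => (1 - gamma) * q x); last first.
  apply/funext => x; rewrite big_split_ord /=.
  rewrite [X in _ - (X + _)](_ : _ = \sum_i c i * sX i x); last first.
    by apply: eq_bigr => i _; rewrite spl.
  rewrite [X in _ - (_ + X)](_ : _ = - gamma * \sum_i c i * sX i x); last first.
    by rewrite mulr_sumr; apply: eq_bigr => i _; rewrite spr; ring.
  by rewrite /q; ring.
rewrite /= oss_inner_projection//.
have [rL _ _] := rq.
have : ip P0 r r < e.
  rewrite -lte_fin -ipE//; move: approx; rewrite expectation.unlock.
  by under eq_integral do rewrite expr2.
by have := mulr_ge0 (ltW gamma0) (ip_ge0 Q0 q); lra.
Qed.

Lemma oss_gradient_projection p (theta : probability (X * Y)%type R -> 'cV[R]_p)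
    (f : X * Y -> 'cV[R]_p) (g : X -> 'cV[R]_p) :
  is_gradient model theta P0 f ->
  (forall i, is_projection P0 (coordinate f i) (coordinate g i)) ->
  L20vec Q0 g ->
  is_oss_gradient gamma model P0 theta (fun z => f z - gamma *: g z.1)
    (fun x => (1 - gamma) *: g x).
Proof.
move=> [f20 fgrad] fg g20.
have fE i : coordinate (fun z => f z - gamma *: g z.1) i =
    (fun z => coordinate f i z - gamma * coordinate g i z.1).
  by apply/funext => z; rewrite /coordinate !mxE.
have gE i : coordinate (fun x => (1 - gamma) *: g x) i =
    (fun x => (1 - gamma) * coordinate g i x).
  by apply/funext => z; rewrite /coordinate !mxE.
split.
- by move=> i; rewrite fE; apply: L20B => //; apply: L20Z; exact: L20_comp_fst.
- by move=> i; rewrite gE; exact: L20Z.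
move=> I t0 P s sX ssX i; have [reg _] := ssX.
have [sL sXL sp] := oss_score_projection ssX.
have [fL gL fgp] := fg i; have hL := Lfun2_comp_fst gL.
have zL := Lfun2Z gamma hL; have zL' := Lfun2Z (1 - gamma) gL.
rewrite (_ : oss_inner _ _ _ _ _ _ = ip P0 (coordinate f i) s); first exact: (fgrad _ _ _ _ reg i).
rewrite fE gE /oss_inner -/(ip P0 _ _) -/(ip Q0 _ _).
rewrite ipBr// ipZr// sp// ipZr// (ipC P0 s) -/Q0.
by field; rewrite gt_eqF// subr_gt0.
Qed.

(* Cauchy-Schwarz in Young's form, for d orthogonal to the scores and (f, g) in
   their closed span. *)
Lemma oss_tangent_orthogonal (f u : X * Y -> R) (g v : X -> R) (k e : R) :
  oss_tangent_space gamma model P0 f g ->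
  u \in Lfun P0 2%:E -> v \in Lfun Q0 2%:E ->
  (forall I t0 P s sX, oss_score model P0 I t0 P s sX ->
    oss_inner gamma P0 s sX u v = 0) ->
  k ^+ 2 = 1 -> 0 < e ->
  k * oss_inner gamma P0 u v f g <= oss_inner gamma P0 u v u v / 4 + e.
Proof.
move=> [[fL _] [gL _] fg] uL vL orth k2 e0.
have [n [c [s [sX [sk]]]]] := fg e e0.
set rf := fun z => _; set rg := fun x => _; rewrite /= => re.
have sL i : s i \in Lfun P0 2%:E /\ sX i \in Lfun Q0 2%:E.
  by have [I [t0 [P h]]] := sk i; have [] := oss_score_projection h.
have SL := Lfun2_sum c (fun i => (sL i).1).
have SXL := Lfun2_sum c (fun i => (sL i).2).
have rfL : rf \in Lfun P0 2%:E by exact: Lfun2B.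
have rgL : rg \in Lfun Q0 2%:E by exact: Lfun2B.
pose q := gamma / (1 - gamma).
have q0 : 0 <= q by rewrite divr_ge0// ?subr_ge0; exact: ltW.
(* The approximant is orthogonal to (u, v), so only the residual remains. *)
have E : oss_inner gamma P0 u v f g = ip P0 u rf + q * ip Q0 v rg.
  rewrite /oss_inner -/(ip P0 _ _) -/(ip Q0 _ _) -/q.
  rewrite !ipBr// (ipC P0 u (fun z => \sum_k _)) (ipC Q0 v (fun z => \sum_k _)).
  rewrite !ip_suml//; try by move=> i; have [] := sL i.
  have : \sum_i c i * (ip P0 (s i) u + q * ip Q0 (sX i) v) = 0.
    apply: big1 => i _; have [I [t0 [P h]]] := sk i.
    by have := orth _ _ _ _ _ h; rewrite /oss_inner -/(ip P0 _ _) -/(ip Q0 _ _) -/q => ->; rewrite mulr0.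
  under eq_bigr do rewrite mulrDr mulrCA.
  rewrite big_split /= -mulr_sumr => S0.
  by rewrite mulrBr; lra.
have y1 := ip_young uL rfL k2; have y2 := ip_young vL rgL k2.
move: re; rewrite E /oss_inner -!/(ip _ _ _) -/q => re.
have y3 : q * (k * ip Q0 v rg) <= q * (ip Q0 v v / 4 + ip Q0 rg rg) by rewrite ler_wpM2l.
lra.
Qed.

End oss_theory.

Section conditional_expectation_projection.
Context dX dY (X : measurableType dX) (Y : measurableType dY) (R : realType).
Variable P0 : probability (X * Y)%type R.
Let Q0 := marginal P0.

(** Testing the projection against the constant 1 shows that both means agree. *)
Lemma is_projection_L20 f g : is_projection P0 f g -> L20 P0 f -> L20 Q0 g.
Proof.
move=> [fL gL fg] [_ f0]; split=> //.
have oneL : (fun=> 1 : R) \in Lfun Q0 2%:E by exact: Lfun_cst.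
have E d (T : measurableType d) (P : probability T R) (u : T -> R) :
    u \in Lfun P 2%:E -> (fun=> 1 : R) \in Lfun P 2%:E ->
    ('E_P[u] = (ip P u (fun=> 1))%:E)%E.
  move=> uL oL; rewrite -ipE// expectation.unlock.
  by apply: eq_integral => x _; rewrite mulr1.
by rewrite E// -fg// -E ?f0//; exact: Lfun_cst.
Qed.

Lemma cond_exp_projection p (K : R.-pker X ~> Y)
    (f : X * Y -> 'cV[R]_p) (phi : X -> 'cV[R]_p) :
  (forall A, measurable A -> P0 A = joint Q0 K A) ->
  L20vec P0 f -> is_cond_exp P0 f phi ->
  forall i, is_projection P0 (coordinate f i) (coordinate phi i).
Proof.
move=> P0E f20 fphi i; have [fL _] := f20 i; have [iphi phiE] := fphi i.
apply: (is_projection_ae P0E) => //; first exact/measurable_EFinP/(measurable_int _ iphi).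
apply: (ae_eq_kmean P0E) => // B mB.
have := phiE B mB; rewrite [X in X = _ -> _]integral_mkcond [X in _ = X -> _]integral_mkcond => H.
transitivity (\int[Q0]_x ((fun x => (coordinate phi i x)%:E) \_ B) x)%E.
  by apply: eq_integral => x _; rewrite patchE indicE; case: (_ \in _); rewrite ?mul1r ?mul0r.
rewrite H; apply: eq_integral => z _; rewrite patchE indicE.
rewrite (_ : (z \in fst @^-1` B) = (z.1 \in B)); last by apply/idP/idP; rewrite !inE.
by case: (_ \in _); rewrite ?mul1r ?mul0r.
Qed.

End conditional_expectation_projection.

(** * Uniqueness of the canonical gradient and of the efficiency bound *)

Section efficiency_bound.
Context dX dY (X : measurableType dX) (Y : measurableType dY) (R : realType).
Variables (PX : set (probability X R)) (PYX : set (R.-pker X ~> Y)).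
Variables (gamma : R) (P0 : probability (X * Y)%type R).
Hypotheses (P0_model : product_model PX PYX P0) (gamma01 : 0 < gamma < 1).
Let model := product_model PX PYX.
Let Q0 := marginal P0.
Variables (p : nat) (theta : probability (X * Y)%type R -> 'cV[R]_p).
Let q := gamma / (1 - gamma).
Let q0 : 0 < q. Proof. by have /andP[g0 g1] := gamma01; rewrite divr_gt0// subr_gt0. Qed.

Lemma lincomb_delta d (T : measurableType d) (f : T -> 'cV[R]_p) i :
  lincomb (delta_mx i 0) f = coordinate f i.
Proof. by apply/funext => u; rewrite /lincomb /coordinate trmx_delta -rowE mxE. Qed.

(** In the equality of functions of (z, x), the variables separate up to a constant, and centering
    makes this constant 0. *)
Lemma oss_eif_components phi1 phi2 :
  is_oss_eif gamma model P0 theta phi1 phi2 ->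
  exists f g, [/\ is_oss_gradient gamma model P0 theta f g,
    (forall a, oss_tangent_space gamma model P0 (lincomb a f) (lincomb a g)) &
    forall i j, (covmx P0 phi1 + covmx Q0 phi2) i j =
      oss_inner gamma P0 (coordinate f i) (coordinate g i)
        (coordinate f j) (coordinate g j)].
Proof.
move=> [phi10 phi20 [f [g [DE grad tan]]]]; exists f, g; split=> // i j.
have [f20 g20 _] := grad.
have DEi k z x : coordinate phi1 k z + Num.sqrt q * coordinate phi2 k x =
    coordinate f k z + q * coordinate g k x.
  by have := congr1 (fun h : X * Y * X -> 'cV[R]_p => h (z, x) k 0) DE; rewrite /oss_fun !mxE.
have E1 k : coordinate phi1 k = coordinate f k.
  pose c := q * coordinate g k point - Num.sqrt q * coordinate phi2 k point.
  have cE z : coordinate phi1 k z = coordinate f k z + c.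
    by have := DEi k z point; rewrite /c; lra.
  have [fL f0] := f20 k; have [_ h0] := phi10 k.
  have f1 := Lfun_subset12 (fin_num_measure P0 _ measurableT) fL.
  have := expectationD f1 (Lfun_cst P0 c 1).
  rewrite f0 expectation_cst add0e => Ec.
  have c0 : c = 0.
    apply: EFin_inj; rewrite -Ec; transitivity ('E_P0[coordinate phi1 k])%E; last exact: h0.
    congr (expectation P0 _).
    by apply/funext => z; rewrite cE.
  by apply/funext => z; rewrite cE c0 addr0.
have E2 k : (fun x => Num.sqrt q * coordinate phi2 k x) =
    (fun x => q * coordinate g k x).
  by apply/funext => x; have := DEi k point x; rewrite E1 => /addrI.
have phi2L k : coordinate phi2 k \in Lfun Q0 2%:E by have [] := phi20 k.
have gL k : coordinate g k \in Lfun Q0 2%:E by have [] := g20 k.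
rewrite !mxE !ip_L20// !E1 /= /oss_inner -/(ip P0 _ _) -/(ip Q0 _ _) -/q.
congr (_ + _).
(* From sqrt q phi2 = q g, the inner products satisfy q <phi2, phi2> = q^2 <g, g>; dividing by q
   leaves the weight q of the OSS inner product. *)
have := congr1 (fun h : X -> R => ip Q0 h (fun x => Num.sqrt q * coordinate phi2 j x)) (E2 i).
rewrite [in RHS]E2 !ipZl ?Lfun2Z// !ipZr// mulrA -expr2 sqr_sqrtr; last exact: ltW.
by move/(mulfI (lt0r_neq0 q0)).
Qed.

(** Canonical gradients coincide only almost everywhere, so uniqueness is expressed through the
    inner products, which do not see null sets. *)
Lemma oss_canonical_unique f g f' g' :
  is_oss_gradient gamma model P0 theta f g ->
  (forall a, oss_tangent_space gamma model P0 (lincomb a f) (lincomb a g)) ->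
  is_oss_gradient gamma model P0 theta f' g' ->
  (forall a, oss_tangent_space gamma model P0 (lincomb a f') (lincomb a g')) ->
  forall i j,
    oss_inner gamma P0 (coordinate f i) (coordinate g i)
      (coordinate f j) (coordinate g j)
    = oss_inner gamma P0 (coordinate f' i) (coordinate g' i)
      (coordinate f' j) (coordinate g' j).
Proof.
move=> [f20 g20 fgrad] fgtan [f20' g20' fgrad'] fgtan'.
have fL k : coordinate f k \in Lfun P0 2%:E by have [] := f20 k.
have gL k : coordinate g k \in Lfun Q0 2%:E by have [] := g20 k.
have fL' k : coordinate f' k \in Lfun P0 2%:E by have [] := f20' k.
have gL' k : coordinate g' k \in Lfun Q0 2%:E by have [] := g20' k.
suff ae i : {ae P0, forall z, coordinate f i z = coordinate f' i z} /\
    {ae Q0, forall x, coordinate g i x = coordinate g' i x}.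
  move=> i j; have [? ?] := ae i; have [? ?] := ae j.
  by rewrite /oss_inner -!/(ip _ _ _); congr (_ + _ * _); exact: eq_ip.
pose u z := coordinate f i z - coordinate f' i z.
pose v x := coordinate g i x - coordinate g' i x.
have uL : u \in Lfun P0 2%:E by exact: Lfun2B.
have vL : v \in Lfun Q0 2%:E by exact: Lfun2B.
(* Both gradients represent the same derivative along every submodel. *)
have orth I t0 P s sX : oss_score model P0 I t0 P s sX ->
    oss_inner gamma P0 s sX u v = 0.
  move=> ssX; have [sL sXL _] := oss_score_projection P0_model ssX.
  have := @derive_val _ _ _ _ _ _ _ (fgrad _ _ _ _ _ ssX i).
  rewrite (@derive_val _ _ _ _ _ _ _ (fgrad' _ _ _ _ _ ssX i)).
  rewrite /oss_inner -!/(ip _ _ _) !ipBr// => E.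
  by rewrite mulrBr; lra.
pose N := oss_inner gamma P0 u v u v.
have NE : N = oss_inner gamma P0 u v (coordinate f i) (coordinate g i) -
    oss_inner gamma P0 u v (coordinate f' i) (coordinate g' i).
  rewrite /N {2}/u {2}/v /oss_inner -!/(ip _ _ _) !ipBr// mulrBr.
  by rewrite opprD !addrA; lra.
(* Each gradient lies in the tangent space and is treated separately, with k = 1 and k = -1. The two
   bounds add up to N <= N / 2 + e / 2, hence N <= e. *)
have N0 : N <= 0.
  apply/ler_addgt0Pr => e e0; rewrite add0r.
  have e4 : 0 < e / 4 by rewrite divr_gt0.
  have t1 := fgtan (delta_mx i 0); have t2 := fgtan' (delta_mx i 0).
  rewrite !lincomb_delta in t1 t2.
  have h1 := oss_tangent_orthogonal P0_model gamma01 t1 uL vL orth (expr1n _ 2) e4.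
  have m1 : (-1 : R) ^+ 2 = 1 by rewrite sqrrN expr1n.
  have h2 := oss_tangent_orthogonal P0_model gamma01 t2 uL vL orth m1 e4.
  rewrite -/N in h1 h2; move: h1 h2; rewrite NE; lra.
have u0 := ip_ge0 P0 u; have v0 := ip_ge0 Q0 v.
have qv0 : 0 <= q * ip Q0 v v by rewrite mulr_ge0// ltW.
have NN : N = ip P0 u u + q * ip Q0 v v by [].
have uu : ip P0 u u = 0 by apply/eqP; rewrite eq_le u0 andbT; move: NN N0 qv0; lra.
have vv : ip Q0 v v = 0.
  have : q * ip Q0 v v = 0 by apply/eqP; rewrite eq_le qv0 andbT; move: NN N0 u0; lra.
  by move/eqP; rewrite mulf_eq0 gt_eqF//= => /eqP.
split.
- by apply: filterS (ip_eq0_ae uL uu) => z /subr0_eq.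
- by apply: filterS (ip_eq0_ae vL vv) => z /subr0_eq.
Qed.

Lemma oss_eif_covariance_unique phi1 phi2 phi1' phi2' :
  is_oss_eif gamma model P0 theta phi1 phi2 ->
  is_oss_eif gamma model P0 theta phi1' phi2' ->
  covmx P0 phi1 + covmx Q0 phi2 = covmx P0 phi1' + covmx Q0 phi2'.
Proof.
move=> /oss_eif_components[f [g [fg tan cE]]] /oss_eif_components[f' [g' [fg' tan' cE']]].
by apply/matrixP => i j; rewrite cE cE'; exact: oss_canonical_unique.
Qed.

End efficiency_bound.

Theorem theorem4p1 (R : realType) (dX dY : measure_display)
    (X : measurableType dX) (Y : measurableType dY) (p : nat)
    (PX : set (probability X R)) (PYX : set (R.-pker X ~> Y))
    (mu : {sigma_finite_measure set (X * Y)%type -> \bar R})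
    (dominated : forall P, product_model PX PYX P -> P `<< mu)
    (Pstar : probability (X * Y)%type R)
    (Pstar_model : product_model PX PYX Pstar)
    (Theta : set 'cV[R]_p) (theta : probability (X * Y)%type R -> 'cV[R]_p)
    (theta_Theta : forall P, product_model PX PYX P -> Theta (theta P))
    (gamma : R) (gamma01 : 0 < gamma < 1)
    (N : nat -> nat)
    (N_gamma : ((N n)%:R / (n + N n)%:R : R) @[n --> \oo] --> gamma)
    (varphi : X * Y -> 'cV[R]_p)
    (varphi_eif : is_eif (product_model PX PYX) theta Pstar varphi)
    (phi : X -> 'cV[R]_p) (phi_cond_exp : is_cond_exp Pstar varphi phi) :
  is_oss_eif gamma (product_model PX PYX) Pstar theta
    (fun z => varphi z - gamma *: phi z.1)
    (fun x => Num.sqrt (gamma * (1 - gamma)) *: phi x) /\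
  (forall V : 'M[R]_p,
     is_oss_efficiency_bound gamma (product_model PX PYX) Pstar theta V <->
     V = covmx Pstar (fun z => varphi z - gamma *: phi z.1)
         + covmx (marginal Pstar)
             (fun x => Num.sqrt (gamma * (1 - gamma)) *: phi x)) /\
  covmx Pstar (fun z => varphi z - gamma *: phi z.1)
    + covmx (marginal Pstar) (fun x => Num.sqrt (gamma * (1 - gamma)) *: phi x)
  = covmx Pstar varphi - gamma *: covmx (marginal Pstar) phi /\
  covmx Pstar varphi - gamma *: covmx (marginal Pstar) phi
  = covmx Pstar (fun z => varphi z - phi z.1)
    + (1 - gamma) *: covmx (marginal Pstar) phi.
Proof.
have /andP[gamma0 gamma1] := gamma01.
have [K _ P0E] := product_model_kernel Pstar_model.
have [vgrad vtan] := varphi_eif; have [v20 _] := vgrad.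
have proj := cond_exp_projection P0E v20 phi_cond_exp.
have phi20 : L20vec (marginal Pstar) phi.
  by move=> i; apply: is_projection_L20 (proj i) (v20 i).
have lincombE d (T : measurableType d) (f : T -> 'cV[R]_p) a :
    lincomb a f = fun u => \sum_i a i 0 * coordinate f i u.
  by apply/funext => u; rewrite /lincomb mxE; apply: eq_bigr => i _; rewrite mxE.
have projl a : is_projection Pstar (lincomb a varphi) (lincomb a phi).
  by rewrite !lincombE; exact: is_projection_sum.
have grad := oss_gradient_projection Pstar_model gamma01 vgrad proj phi20.
have [f20 _ _] := grad.
have r20 : L20vec (marginal Pstar) (fun x => Num.sqrt (gamma * (1 - gamma)) *: phi x).
  move=> i; rewrite (_ : coordinate _ i =
    fun x => Num.sqrt (gamma * (1 - gamma)) * coordinate phi i x); first exact: L20Z.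
  by apply/funext => x; rewrite /coordinate mxE.
have sq1 : 0 < 1 - gamma by rewrite subr_gt0.
have sq0 : 0 <= 1 - gamma by exact: ltW.
have eif : is_oss_eif gamma (product_model PX PYX) Pstar theta
    (fun z => varphi z - gamma *: phi z.1)
    (fun x => Num.sqrt (gamma * (1 - gamma)) *: phi x).
  split=> //; exists (fun z => varphi z - gamma *: phi z.1), (fun x => (1 - gamma) *: phi x).
  split=> //.
    (* The two normalizations agree: sqrt (gamma / (1 - gamma)) sqrt (gamma (1 - gamma)) and (gamma
       / (1 - gamma)) (1 - gamma) are both gamma. *)
    apply/funext => w; rewrite /oss_fun !scalerA; congr (_ + _ *: _).
    rewrite -sqrtrM ?divr_ge0 ?ltW//.
    rewrite (_ : gamma / (1 - gamma) * (gamma * (1 - gamma)) = gamma ^+ 2).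
      rewrite sqrtr_sqr gtr0_norm//; field; lra.
    by field; lra.
  move=> a; rewrite (_ : lincomb a _ =
      fun z => lincomb a varphi z - gamma * lincomb a phi z.1); last first.
    by apply/funext => z; rewrite /lincomb mulmxBr -scalemxAr !mxE.
  rewrite (_ : lincomb a (fun x => _ *: phi x) = fun x => (1 - gamma) * lincomb a phi x); last first.
    by apply/funext => z; rewrite /lincomb -scalemxAr !mxE.
  apply: (oss_tangent_projection Pstar_model gamma01) => //.
  by apply: is_projection_L20 (projl a) _; have [] := vtan a.
split=> //; split.
  move=> V; split; last by move=> ->; eexists _, _; split; [exact: eif|].
  by move=> [phi1 [phi2 [eif' ->]]]; exact: (oss_eif_covariance_unique Pstar_model gamma01 eif' eif).
(* Both equalities of the bound are instances: c = gamma with gamma (2 - gamma) - gamma (1 - gamma)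
   = gamma, and c = 1 with 1 - (1 - gamma) = gamma. *)
have covE (c : R) i j : covmx Pstar (fun z => varphi z - c *: phi z.1) i j =
    covmx Pstar varphi i j - c * (2 - c) * covmx (marginal Pstar) phi i j.
  have cE k : coordinate (fun z => varphi z - c *: phi z.1) k =
      (fun z => coordinate varphi k z - c * coordinate phi k z.1).
    by apply/funext => z; rewrite /coordinate !mxE.
  have c20 k : L20 Pstar (fun z => coordinate varphi k z - c * coordinate phi k z.1).
    by apply: L20B => //; apply: L20Z; exact: L20_comp_fst.
  by rewrite !mxE !cE !ip_L20//= ip_projection.
have covZ i j : covmx (marginal Pstar) (fun x => Num.sqrt (gamma * (1 - gamma)) *: phi x) i j =
    gamma * (1 - gamma) * covmx (marginal Pstar) phi i j.
  have cE k : coordinate (fun x => Num.sqrt (gamma * (1 - gamma)) *: phi x) k =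
      (fun x => Num.sqrt (gamma * (1 - gamma)) * coordinate phi k x).
    by apply/funext => z; rewrite /coordinate !mxE.
  have phiL k : coordinate phi k \in Lfun (marginal Pstar) 2%:E by have [] := phi20 k.
  rewrite !mxE !ip_L20 ?r20//= !cE ipZl ?Lfun2Z// ipZr// mulrA -expr2 sqr_sqrtr//.
  by rewrite mulr_ge0// ltW.
have scE (c : R) (A : 'M[R]_p) i j : (c *: A) i j = c * A i j by rewrite mxE.
have opE (A : 'M[R]_p) i j : (- A) i j = - A i j by rewrite mxE.
split; apply/matrixP => i j; rewrite [LHS]mxE [RHS]mxE opE !scE.
- by rewrite covE covZ; ring.
- have -> : (fun z => varphi z - phi z.1) = (fun z => varphi z - 1 *: phi z.1).
    by apply/funext => z; rewrite scale1r.
  by rewrite covE; ring.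
Qed.
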